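(* Let $m\ge3$ be odd and $0\le i\le m-2$. With $\tilde f_m^i,\hat f_m^i,g_m^i$ defined below (and $\tilde f_m^0:=0$), regarded as functions of $(w,z)$ via $s=zw$, $t=z\sqrt{1-w^2}$, the following expansions hold. If $i$ is even ($i=0,2,\dots,m-3$): $$\tilde f_m^i=-i\,2^{m/2-2}\Gamma(\tfrac m2-1)\sum_{j=0}^\infty(4j+m)\frac{(2j+i-1)!!}{(2j+m-i-1)!!}z^{-m/2+1}J_{2j+m/2}(z)C_{2j+1}^{m/2-1}(w),$$ $$\hat f_m^i=(-1)^{(m+1)/2}2^{m/2-1}\Gamma(\tfrac m2-1)\sum_{j=0}^\infty(2j+\tfrac m2-1)\frac{(2j+i-1)!!}{(2j-i+m-3)!!}z^{1-m/2}J_{2j+m/2-1}(z)C_{2j}^{m/2-1}(w),$$ $$g_m^i=2^{m/2-1}\Gamma(\tfrac m2)\sum_{j=0}^\infty(4j+m)\frac{(2j+i-1)!!}{(2j+m-i-1)!!}z^{-m/2}J_{2j+m/2}(z)C_{2j}^{m/2}(w).$$ If $i$ is odd ($i=1,3,\dots,m-2$): $$\tilde f_m^i=-i\,2^{m/2-2}\Gamma(\tfrac m2-1)\sum_{j=0}^\infty(4j+m-2)\frac{(2j+i-2)!!}{(2j+m-i-2)!!}z^{-m/2+1}J_{2j+m/2-1}(z)C_{2j}^{m/2-1}(w),$$ $$\hat f_m^i=-(-1)^{(m+1)/2}2^{m/2-1}\Gamma(\tfrac m2-1)\sum_{j=0}^\infty(2j+\tfrac m2)\frac{(2j+i)!!}{(2j+m-i-2)!!}z^{1-m/2}J_{2j+m/2}(z)C_{2j+1}^{m/2-1}(w),$$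 $$g_m^i=2^{m/2-1}\Gamma(\tfrac m2)\sum_{j=0}^\infty(4j+m+2)\frac{(2j+i)!!}{(2j+m-i)!!}z^{-m/2}J_{2j+m/2+1}(z)C_{2j+1}^{m/2}(w).$$
   Context: For $m$ odd and $i\ge0$: $\tilde f_m^i(s,t)=-\sum_{\ell=0}^{\lfloor (i-1)/2\rfloor}s^{i-1-2\ell}\frac{1}{2^\ell\ell!}\frac{\Gamma(i+1)}{\Gamma(i-2\ell)}\widetilde J_{(m-2\ell-3)/2}(t)$ for $i\ge1$, $\tilde f_m^0:=0$; $\hat f_m^i(s,t)=(-1)^{(m+1)/2+i}\sum_{\ell=0}^{\lfloor i/2\rfloor}s^{i-2\ell}\frac{1}{2^\ell\ell!}\frac{\Gamma(i+1)}{\Gamma(i+1-2\ell)}\widetilde J_{(m-2\ell-3)/2}(t)$; $g_m^i(s,t)=\sum_{\ell=0}^{\lfloor i/2\rfloor}s^{i-2\ell}\frac{1}{2^\ell\ell!}\frac{\Gamma(i+1)}{\Gamma(i+1-2\ell)}\widetilde J_{(m-2\ell-1)/2}(t)$. Here $\widetilde J_\alpha(t)=t^{-\alpha}J_\alpha(t)$, $J_\nu$ Bessel functions, $C_k^\lambda$ Gegenbauer polynomials; double factorials $u!!=u(u-2)\cdots$ down to $1$ or $2$, with $0!!=(-1)!!=1$. In the paper's setting $s=\langle\underline{x},\underline{y}\rangle$, $t=|\underline{x}\wedge\underline{y}|$, $z=|\underline{x}||\underline{y}|$, $w=\langle\underline{x}/|\underline{x}|,\underline{y}/|\underline{y}|\rangle$.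 *)

(* Defs.v *)
From Stdlib Require Import Reals Lra Lia ZArith.
From Coquelicot Require Import Coquelicot.
Open Scope R_scope.

(* Euler Gamma function, Gamma(x) = int_0^oo t^(x-1) e^(-t) dt  (used only for x > 0). *)
Definition Gamma (x : R) : R :=
  RInt_gen (fun t => Rpower t (x - 1) * exp (- t)) (at_right 0) (Rbar_locally p_infty).

(* Bessel function of the first kind, for x > 0:
   J_nu(x) = sum_k (-1)^k / (k! Gamma(k+nu+1)) (x/2)^(2k+nu). *)
Definition BesselJ (nu x : R) : R :=
  Series (fun k => (-1) ^ k / (INR (fact k) * Gamma (INR k + nu + 1)) * (x / 2) ^ (2 * k))
  * Rpower (x / 2) nu.

(* Jtilde_alpha(t) = t^(-alpha) J_alpha(t), written as its (entire) power series so that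
   it is also defined at t = 0 (continuous extension):
   Jtilde_alpha(t) = 2^(-alpha) sum_k (-1)^k / (k! Gamma(k+alpha+1)) (t/2)^(2k). *)
Definition Jtilde (alpha t : R) : R :=
  Series (fun k => (-1) ^ k / (INR (fact k) * Gamma (INR k + alpha + 1)) * (t / 2) ^ (2 * k))
  / Rpower 2 alpha.

(* Gegenbauer polynomials C_n^lambda(x), via the standard three-term recurrence
   C_0 = 1, C_1 = 2 lambda x,
   n C_n = 2 x (n + lambda - 1) C_{n-1} - (n + 2 lambda - 2) C_{n-2}. *)
Fixpoint gegen_pair (lam x : R) (n : nat) : R * R :=
  (* returns (C_n, C_{n+1}) *)
  match n with
  | O => (1, 2 * lam * x)
  | S n' =>
      let (a, b) := gegen_pair lam x n' in
      let k := INR n' + 2 in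
      (b, (2 * x * (k + lam - 1) * b - (k + 2 * lam - 2) * a) / k)
  end.
Definition Gegenbauer (n : nat) (lam x : R) : R := fst (gegen_pair lam x n).

Fixpoint dfact_nat (n : nat) : nat :=
  match n with
  | O => 1%nat
  | S O => 1%nat
  | S (S k as p) => (n * dfact_nat k)%nat
  end.
(* on integers >= -1 (the only arguments used) : (-1)!! = 1 *)
Definition dfact (u : Z) : R := INR (dfact_nat (Z.to_nat u)).

Definition ftilde (m i : nat) (s t : R) : R :=
  match i with
  | O => 0
  | S _ =>
    - sum_f_R0 (fun l => s ^ (i - 1 - 2 * l) * (1 / (2 ^ l * INR (fact l)))
                  * (Gamma (INR i + 1) / Gamma (INR i - 2 * INR l))
                  * Jtilde ((INR m - 2 * INR l - 3) / 2) t)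
        ((i - 1) / 2)
  end.

Definition fhat (m i : nat) (s t : R) : R :=
  (-1) ^ ((m + 1) / 2 + i) *
  sum_f_R0 (fun l => s ^ (i - 2 * l) * (1 / (2 ^ l * INR (fact l)))
                * (Gamma (INR i + 1) / Gamma (INR i + 1 - 2 * INR l))
                * Jtilde ((INR m - 2 * INR l - 3) / 2) t)
    (i / 2).

Definition gfun (m i : nat) (s t : R) : R :=
  sum_f_R0 (fun l => s ^ (i - 2 * l) * (1 / (2 ^ l * INR (fact l)))
                * (Gamma (INR i + 1) / Gamma (INR i + 1 - 2 * INR l))
                * Jtilde ((INR m - 2 * INR l - 1) / 2) t)
    (i / 2).

Definition sv (z w : R) : R := z * w.
Definition tv (z w : R) : R := z * sqrt (1 - w ^ 2).

(* Main.v *)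
Require Import Defs.
From Stdlib Require Import Reals ZArith Lra Lia.
From Coquelicot Require Import Coquelicot.
Open Scope R_scope.

(* With [lam = m / 2], [x = z / 2] and [F_nu(z) = (z/2)^(-nu) J_nu(z)], all six expansions are
   instances of
     [g_m^i = Gamma(lam) * sum_k c_k (k + lam) F_(k+lam)(z) x^k C_k^lam(w)],
   where [c_k = (k+i-1)!! / (k+m-i-1)!!] for [k + i] even and [c_k = 0] otherwise, because
   [ftilde_m^i = - i g_(m-2)^(i-1)] and [fhat_m^i = (-1)^((m+1)/2+i) g_(m-2)^i].
   This is proved by induction on [i] from the Hermite-type recurrence
   [g_m^(i+1) = s g_m^i + i g_(m-2)^(i-1)], which the three-term recurrences of the Bessel
   functions and Gegenbauer polynomials reduce to
     [c_k^(m,i+1) = k c_(k-1)^(m,i) + i c_k^(m-2,i-1)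
                  = (k+m) c_(k+1)^(m,i) - i c_(k+2)^(m-2,i-1)].
   For [i = 0] the two sides are compared as power series in [z]: the coefficient of [z^(2q)]
   is the Gegenbauer expansion of [(1 - w^2)^q], obtained by induction on [q] from the formula
   for [(1 - w^2) C_n^(lam+1)(w)] in terms of [C_n^lam(w)] and [C_(n+2)^lam(w)]. *)

(** * The Gamma function *)

(** Why two coefficient identities: multiplication by [s = z w] moves degree k to k - 1 and k + 1,
    while [nu F_nu = F_(nu-1) + (z/2)^2 F_(nu+1)] splits each target term into two Bessel orders. At
    a fixed degree, each of the two orders imposes one condition on the coefficients. The
    contribution of m - 2 must first be rewritten from parameter lam - 1 to lam, which turns each
    polynomial into a difference of two; hence the opposite signs of the two terms in [c^(m-2,i-1)].
    Dividing J_nu by (z/2)^nu leaves functions with factorial decay in the order, so every series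
    met converges absolutely once its other factors grow at most exponentially, and it may be split
    and shifted freely. The bound i <= m is stable under (m, i+2) -> (m-2, i). It keeps the Bessel
    orders in the finite sums nonnegative integers and, with the parity condition, the arguments of
    the denominators nonnegative. Since [ftilde] and [fhat] live in dimension m - 2, it reads i <= m
    - 2 for them. [Gamma] being an improper integral, its existence, positivity and functional
    equation have to be established before anything else. *)

Lemma exp_increasing_le (x y : R) : x <= y -> exp x <= exp y.
Proof.
  intros [H | ->]; [now apply Rlt_le, exp_increasing | apply Rle_refl].
Qed.

Lemma Rpower_S (t x : R) : 0 < t -> Rpower t (x + 1) = Rpower t x * t.
Proof. intros Ht. now rewrite Rpower_plus, Rpower_1. Qed.

Lemma Rpower_minus_1 (t x : R) : 0 < t -> Rpower t (x - 1) = Rpower t x / t.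
Proof.
  intros Ht. replace (Rpower t x) with (Rpower t (x - 1) * t).
  - field. lra.
  - rewrite <- Rpower_S by assumption. f_equal. ring.
Qed.

Lemma Rpower_pos (t x : R) : 0 < Rpower t x.
Proof. apply exp_pos. Qed.

(** Integrals of a positive function grow with the interval, so the improper integral is the
    supremum of the integrals over compact intervals. Positivity of the limit is recorded because
    values of [Gamma] are divided by later. *)
Lemma is_RInt_gen_pos_bounded (f : R -> R) (B : R) :
  (forall t, 0 < t -> 0 < f t) ->
  (forall t, 0 < t -> continuous f t) ->
  (forall a b, 0 < a -> a <= b -> RInt f a b <= B) ->
  exists L, 0 < L /\ is_RInt_gen f (at_right 0) (Rbar_locally p_infty) L.
Proof.
  intros Hpos Hcont Hbd.
  assert (Hex : forall a b, 0 < a -> 0 < b -> ex_RInt f a b).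
  { intros a b Ha Hb. apply (ex_RInt_continuous (V := R_CompleteNormedModule)).
    intros z [Hz _]. apply Hcont. eapply Rlt_le_trans; [| exact Hz].
    now apply Rmin_glb_lt. }
  set (E := fun v => exists a b, 0 < a /\ a <= b /\ v = RInt f a b).
  destruct (completeness E) as [L [HL1 HL2]].
  { exists B. intros v (a & b & Ha & Hab & ->). now apply Hbd. }
  { exists (RInt f 1 2), 1, 2. repeat split; lra. }
  exists L. split.
  { apply Rlt_le_trans with (RInt f 1 2).
    - apply RInt_gt_0; [lra | |]; intros x Hx; [apply Hpos | apply Hcont]; lra.
    - apply HL1. exists 1, 2. repeat split; lra. }
  intros P [eps HP].
  (* One interval comes within [eps] of the supremum; every interval containing it then does too. *)
  assert (Hnear : exists a0 b0, 0 < a0 /\ a0 <= b0 /\ L - eps < RInt f a0 b0).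
  { apply Classical_Prop.NNPP. intros Hno.
    assert (L <= L - eps).
    { apply HL2. intros v (a & b & Ha & Hab & ->).
      destruct (Rle_or_lt (RInt f a b) (L - eps)) as [H | H]; [assumption |].
      exfalso. apply Hno. now exists a, b. }
    pose proof (cond_pos eps). lra. }
  destruct Hnear as (a0 & b0 & Ha0 & Hab0 & Hlt).
  apply Filter_prod with (Q := fun a => 0 < a < a0) (R := fun b => b0 < b).
  - exists (mkposreal a0 Ha0). intros y Hy Hy0. split; [assumption |].
    unfold ball in Hy; simpl in Hy; unfold AbsRing_ball, abs, minus, plus, opp in Hy;
      simpl in Hy. apply Rabs_lt_between in Hy. lra.
  - now exists b0.
  - intros a b [Ha Haa] Hb. exists (RInt f a b). simpl. split.
    + apply (RInt_correct (V := R_CompleteNormedModule)). apply Hex; lra.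
    + apply HP.
      assert (RInt f a b <= L) by (apply HL1; exists a, b; repeat split; lra).
      assert (RInt f a0 b0 <= RInt f a b).
      { rewrite <- (RInt_Chasles f a a0 b), <- (RInt_Chasles f a0 b0 b); try (apply Hex; lra).
        unfold plus; simpl.
        assert (0 <= RInt f a a0)
          by (apply RInt_ge_0; [lra | apply Hex; lra | intros x Hx; apply Rlt_le, Hpos; lra]).
        assert (0 <= RInt f b0 b)
          by (apply RInt_ge_0; [lra | apply Hex; lra | intros x Hx; apply Rlt_le, Hpos; lra]).
        lra. }
      unfold ball; simpl; unfold AbsRing_ball, abs, minus, plus, opp; simpl.
      apply Rabs_lt_between. lra.
Qed.

Definition Gamma_integrand (x t : R) : R := Rpower t (x - 1) * exp (- t).

Lemma continuous_Gamma_integrand (x t : R) : 0 < t -> continuous (Gamma_integrand x) t.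
Proof.
  intros Ht. apply (ex_derive_continuous (V := R_NormedModule)).
  unfold Gamma_integrand, Rpower. auto_derive. assumption.
Qed.

(** From 1 + t <= 2 (1 + t/2) and 1 + t/2 <= exp (t/2). It replaces exp (-t) by a rational
    majorant. *)
Lemma one_plus_sqr_le_exp (t : R) : 0 < t -> (1 + t) ^ 2 <= 4 * exp t.
Proof.
  intros Ht. replace (exp t) with (exp (t / 2) * exp (t / 2))
    by (rewrite <- exp_plus; f_equal; field).
  pose proof (exp_ineq1_le (t / 2)). nra.
Qed.

(* The integrand is dominated by the derivative of the bounded function
   [4 / x * (t / (1 + t)) ^ x]. *)
Lemma ex_Gamma_small (x : R) : 0 < x <= 1 ->
  exists L, 0 < L /\ is_RInt_gen (Gamma_integrand x) (at_right 0) (Rbar_locally p_infty) L.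
Proof.
  intros Hx. apply (is_RInt_gen_pos_bounded _ (4 / x)).
  - intros t _. apply Rmult_lt_0_compat; apply exp_pos.
  - apply continuous_Gamma_integrand.
  - intros a b Ha Hab.
    set (h := fun t => 4 / x * Rpower (t / (1 + t)) x).
    set (dh := fun t => 4 / (t * (1 + t)) * Rpower (t / (1 + t)) x).
    assert (Hint : is_RInt dh a b (h b - h a)).
    { apply (is_RInt_derive (V := R_CompleteNormedModule) h dh).
      - intros t [Ht _]. rewrite Rmin_left in Ht by assumption.
        unfold h, dh, Rpower. auto_derive.
        + split; [lra |]. split; [| trivial]. apply Rdiv_lt_0_compat; lra.
        + unfold Rdiv. field. repeat split; lra.
      - intros t [Ht _]. rewrite Rmin_left in Ht by assumption.
        apply (ex_derive_continuous (V := R_NormedModule)).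
        unfold dh, Rpower. auto_derive. repeat split.
        + apply Rmult_integral_contrapositive_currified; lra.
        + lra.
        + apply Rdiv_lt_0_compat; lra. }
    apply Rle_trans with (RInt dh a b).
    + apply RInt_le; [assumption | | now eexists; apply Hint |].
      * apply (ex_RInt_continuous (V := R_CompleteNormedModule)). intros t [Ht _].
        rewrite Rmin_left in Ht by assumption. apply continuous_Gamma_integrand. lra.
      * intros t Ht. assert (Ht0 : 0 < t) by lra.
        unfold Gamma_integrand, dh. rewrite Rpower_minus_1 by assumption.
        unfold Rdiv at 3.
        rewrite <- Rpower_mult_distr by (try apply Rinv_0_lt_compat; lra).
        (* Here x <= 1 enters: a number in (0, 1) does not decrease when raised to such a power. *)
        assert (Hlow : / (1 + t) <= Rpower (/ (1 + t)) x).
        { rewrite <- (Rpower_1 (/ (1 + t))) at 1 by (apply Rinv_0_lt_compat; lra).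
          unfold Rpower. apply exp_increasing_le.
          rewrite ln_Rinv by lra.
          assert (0 < ln (1 + t)) by (rewrite <- ln_1; apply ln_increasing; lra).
          nra. }
        pose proof (Rpower_pos t x) as Hp.
        assert (He : exp (- t) <= 4 / (1 + t) * Rpower (/ (1 + t)) x).
        { apply Rle_trans with (4 / (1 + t) * / (1 + t)).
          - rewrite exp_Ropp. pose proof (one_plus_sqr_le_exp t Ht0).
            pose proof (exp_pos t).
            replace (4 / (1 + t) * / (1 + t)) with (4 / (1 + t) ^ 2) by (field; lra).
            apply (Rmult_le_reg_r (exp t * (1 + t) ^ 2)).
            + apply Rmult_lt_0_compat; [lra |]. apply pow_lt; lra.
            + replace (/ exp t * (exp t * (1 + t) ^ 2)) with ((1 + t) ^ 2) by (field; lra).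
              replace (4 / (1 + t) ^ 2 * (exp t * (1 + t) ^ 2)) with (4 * exp t)
                by (field; lra). assumption.
          - apply Rmult_le_compat_l; [| assumption].
            apply Rlt_le, Rdiv_lt_0_compat; lra. }
        replace (4 / (t * (1 + t)) * (Rpower t x * Rpower (/ (1 + t)) x))
          with (Rpower t x / t * (4 / (1 + t) * Rpower (/ (1 + t)) x)) by (field; lra).
        apply Rmult_le_compat_l; [| assumption].
        apply Rlt_le, Rdiv_lt_0_compat; lra.
    + rewrite (is_RInt_unique _ _ _ _ Hint). unfold h.
      assert (Rpower (b / (1 + b)) x <= 1).
      { apply Rle_trans with (exp 0); [| rewrite exp_0; lra]. unfold Rpower. apply exp_increasing_le.
        assert (ln (b / (1 + b)) <= 0).
        { rewrite <- ln_1. apply ln_le.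
          - apply Rdiv_lt_0_compat; lra.
          - apply Rle_div_l; lra. }
        nra. }
      pose proof (Rpower_pos (a / (1 + a)) x).
      assert (Hq : 0 < 4 / x) by (apply Rdiv_lt_0_compat; lra).
      revert Hq. generalize (4 / x). intros q Hq. nra.
Qed.

(** The filters constrain only the end points; once both are positive, so is everything between
    them, in either order. The closed form serves the differentiability conditions, the open form
    below serves changes of integrand. *)
Lemma near_interval_pos (P : R -> Prop) :
  (forall t, 0 < t -> P t) ->
  filter_prod (at_right 0) (Rbar_locally p_infty)
    (fun ab => forall t, Rmin (fst ab) (snd ab) <= t <= Rmax (fst ab) (snd ab) -> P t).
Proof.
  intros HP. apply Filter_prod with (Q := fun a => 0 < a) (R := fun b => 0 < b).
  - now exists (mkposreal 1 Rlt_0_1).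
  - now exists 0.
  - intros a b Ha Hb t [Ht _]. apply HP. simpl in Ht.
    eapply Rlt_le_trans; [| exact Ht]. now apply Rmin_glb_lt.
Qed.

Lemma near_interval_pos_open (P : R -> Prop) :
  (forall t, 0 < t -> P t) ->
  filter_prod (at_right 0) (Rbar_locally p_infty)
    (fun ab => forall t, Rmin (fst ab) (snd ab) < t < Rmax (fst ab) (snd ab) -> P t).
Proof.
  intros HP. eapply filter_imp; [| exact (near_interval_pos P HP)].
  intros ab H t Ht. apply H. lra.
Qed.

Lemma is_RInt_gen_derive_pos (f df : R -> R) (la lb : R) :
  (forall t, 0 < t -> is_derive f t (df t)) ->
  (forall t, 0 < t -> continuous df t) ->
  filterlim f (at_right 0) (locally la) ->
  filterlim f (Rbar_locally p_infty) (locally lb) ->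
  is_RInt_gen df (at_right 0) (Rbar_locally p_infty) (lb - la).
Proof.
  intros Hd Hc Ha Hb.
  apply (is_RInt_gen_ext (Derive f)).
  { apply near_interval_pos_open. intros t Ht. now apply is_derive_unique, Hd. }
  apply is_RInt_gen_Derive; try assumption.
  - apply near_interval_pos. intros t Ht. eexists. now apply Hd.
  - apply near_interval_pos. intros t Ht.
    apply (continuous_ext_loc _ df); [| now apply Hc].
    exists (mkposreal t Ht). intros y Hy. symmetry. apply is_derive_unique, Hd.
    unfold ball in Hy; simpl in Hy; unfold AbsRing_ball, abs, minus, plus, opp in Hy;
      simpl in Hy. apply Rabs_lt_between in Hy. lra.
Qed.

Lemma is_lim_Rpower_mult_exp_0 (x : R) : 0 < x ->
  filterlim (fun t => Rpower t x * exp (- t)) (at_right 0) (locally 0).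
Proof.
  intros Hx.
  apply (filterlim_le_le (F := at_right 0) (fun _ => 0) _ (fun t => Rpower t x) 0).
  - exists (mkposreal 1 Rlt_0_1). intros t _ Ht.
    pose proof (Rpower_pos t x). pose proof (exp_pos (- t)).
    assert (exp (- t) <= 1) by (rewrite <- exp_0; apply exp_increasing_le; lra).
    split; nra.
  - apply filterlim_const.
  - unfold Rpower. eapply filterlim_comp; [| exact is_lim_exp_m].
    apply (filterlim_comp _ _ _ ln (fun y => x * y) _ (Rbar_locally m_infty));
      [exact is_lim_ln_0 |].
    intros P [M HM]. exists (M / x). intros y Hy. apply HM.
    rewrite Rmult_comm. now apply Rlt_div_r.
Qed.

(** The exponent is t (x ln t / t - 1), and ln t / t tends to 0, so it is eventually below -t/2. *)
Lemma is_lim_Rpower_mult_exp_p (x : R) :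
  filterlim (fun t => Rpower t x * exp (- t)) (Rbar_locally p_infty) (locally 0).
Proof.
  apply (filterlim_ext_loc (fun t => exp (x * ln t - t))).
  { exists 0. intros t _. unfold Rpower. rewrite <- exp_plus. f_equal. }
  eapply filterlim_comp; [| exact is_lim_exp_m].
  assert (Hr : filterlim (fun t => x * (ln t / t)) (Rbar_locally p_infty) (locally 0)).
  { replace 0 with (x * 0) by ring.
    apply (is_lim_scal_l (fun t => ln t / t) x p_infty 0 is_lim_div_ln_p). }
  assert (Hhalf : Rbar_locally p_infty (fun t => x * (ln t / t) < / 2)).
  { apply (Hr (fun y => y < / 2)). exists (mkposreal (/ 2) ltac:(lra)). intros y Hy.
    unfold ball in Hy; simpl in Hy; unfold AbsRing_ball, abs, minus, plus, opp in Hy;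
      simpl in Hy. apply Rabs_lt_between in Hy. lra. }
  destruct Hhalf as [N HN]. intros P [M HM].
  exists (Rmax (Rmax N 0) (- 2 * M)). intros t Ht.
  apply Rmax_Rlt in Ht as [Ht Ht3]. apply Rmax_Rlt in Ht as [Ht1 Ht2].
  apply HM. specialize (HN t Ht1).
  replace (x * ln t) with (x * (ln t / t) * t) by (field; lra). nra.
Qed.

(** Integration by parts: [df] is the derivative of t^x exp (-t), which vanishes at both ends, and
    the new integrand is x times the old one minus [df]. *)
Lemma is_Gamma_S (x L : R) : 0 < x ->
  is_RInt_gen (Gamma_integrand x) (at_right 0) (Rbar_locally p_infty) L ->
  is_RInt_gen (Gamma_integrand (x + 1)) (at_right 0) (Rbar_locally p_infty) (x * L).
Proof.
  intros Hx HL.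
  set (df := fun t => x * Gamma_integrand x t - Gamma_integrand (x + 1) t).
  assert (Hd : is_RInt_gen df (at_right 0) (Rbar_locally p_infty) (0 - 0)).
  { apply (is_RInt_gen_derive_pos (fun t => Rpower t x * exp (- t))).
    - intros t Ht. unfold df, Gamma_integrand.
      replace (x + 1 - 1) with x by ring. rewrite Rpower_minus_1 by assumption.
      unfold Rpower. auto_derive; [assumption |]. field. lra.
    - intros t Ht. apply (ex_derive_continuous (V := R_NormedModule)).
      unfold df, Gamma_integrand, Rpower. auto_derive. tauto.
    - now apply is_lim_Rpower_mult_exp_0.
    - apply is_lim_Rpower_mult_exp_p. }
  pose proof (is_RInt_gen_minus _ _ _ _ (is_RInt_gen_scal _ x _ HL) Hd) as H.
  replace (x * L) with (minus (scal x L) (0 - 0))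
    by (unfold minus, scal, plus, opp; simpl; unfold mult; simpl; ring).
  eapply is_RInt_gen_ext; [| exact H].
  apply near_interval_pos_open. intros t _. unfold df.
  unfold minus, scal, plus, opp; simpl; unfold mult; simpl. ring.
Qed.

(** The majorant is available only for x <= 1; larger arguments descend to that range in unit steps
    by the functional equation, any integer above x bounding their number. *)
Lemma ex_Gamma (x : R) : 0 < x ->
  exists L, 0 < L /\ is_RInt_gen (Gamma_integrand x) (at_right 0) (Rbar_locally p_infty) L.
Proof.
  intros Hx. destruct (INR_archimed 1 x Rlt_0_1) as [n Hn]. rewrite Rmult_1_r in Hn.
  revert x Hx Hn. induction n as [| n IH]; intros x Hx Hn; [simpl in Hn; lra |].
  destruct (Rle_or_lt x 1) as [H1 | H1]; [now apply ex_Gamma_small |].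
  rewrite S_INR in Hn. destruct (IH (x - 1)) as (L & HL0 & HL); [lra | lra |].
  exists ((x - 1) * L). split; [nra |].
  replace x with (x - 1 + 1) at 1 by ring. apply is_Gamma_S; [lra | assumption].
Qed.

Lemma Gamma_is_RInt_gen (x L : R) :
  is_RInt_gen (Gamma_integrand x) (at_right 0) (Rbar_locally p_infty) L -> Gamma x = L.
Proof.
  intros H. unfold Gamma.
  change (fun t => Rpower t (x - 1) * exp (- t)) with (Gamma_integrand x).
  refine (is_RInt_gen_unique (V := R_CompleteNormedModule) _ _ H).
Qed.

Lemma Gamma_pos (x : R) : 0 < x -> 0 < Gamma x.
Proof.
  intros Hx. destruct (ex_Gamma x Hx) as (L & HL0 & HL).
  now rewrite (Gamma_is_RInt_gen x L HL).
Qed.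

Lemma Gamma_S (x : R) : 0 < x -> Gamma (x + 1) = x * Gamma x.
Proof.
  intros Hx. destruct (ex_Gamma x Hx) as (L & HL0 & HL).
  rewrite (Gamma_is_RInt_gen x L HL). now apply Gamma_is_RInt_gen, is_Gamma_S.
Qed.

Lemma Gamma_1 : Gamma 1 = 1.
Proof.
  apply Gamma_is_RInt_gen.
  apply (is_RInt_gen_ext (fun t => exp (- t))).
  { apply near_interval_pos_open. intros t Ht. unfold Gamma_integrand.
    replace (1 - 1) with 0 by ring. rewrite Rpower_O by assumption. symmetry. apply Rmult_1_l. }
  assert (E : 0 - - exp (- 0) = 1) by (rewrite Ropp_0, exp_0; ring).
  rewrite <- E.
  apply (is_RInt_gen_derive_pos (fun t => - exp (- t))).
  - intros t _. auto_derive; [trivial |]. ring.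
  - intros t _. apply (ex_derive_continuous (V := R_NormedModule)). auto_derive. trivial.
  - apply (filterlim_filter_le_1 (F := locally 0)).
    + intros P [e He]. exists e. intros y Hy _. now apply He.
    + apply (ex_derive_continuous (V := R_NormedModule) (fun t => - exp (- t))).
      auto_derive. trivial.
  - apply (filterlim_ext_loc (fun t => - (Rpower t 0 * exp (- t)))).
    { exists 0. intros t Ht. rewrite Rpower_O by assumption. ring. }
    pose proof (filterlim_comp _ _ _ _ Ropp _ _ (locally (- 0))
      (is_lim_Rpower_mult_exp_p 0) (filterlim_opp (V := R_NormedModule) 0)) as H.
    rewrite Ropp_0 in H. exact H.
Qed.

Lemma Gamma_nat (n : nat) : Gamma (INR n + 1) = INR (fact n).
Proof.
  induction n as [| n IH].
  - simpl. rewrite Rplus_0_l. apply Gamma_1.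
  - rewrite S_INR, Gamma_S, IH.
    + rewrite fact_simpl, mult_INR, S_INR. ring.
    + pose proof (pos_INR n). lra.
Qed.

(** * Gegenbauer polynomials and Bessel series *)

Lemma Gegenbauer_0 (lam x : R) : Gegenbauer 0 lam x = 1.
Proof. reflexivity. Qed.

Lemma Gegenbauer_1 (lam x : R) : Gegenbauer 1 lam x = 2 * lam * x.
Proof. reflexivity. Qed.

Lemma Gegenbauer_rec (n : nat) (lam x : R) :
  (INR n + 2) * Gegenbauer (S (S n)) lam x =
  2 * x * (INR n + 1 + lam) * Gegenbauer (S n) lam x
  - (INR n + 2 * lam) * Gegenbauer n lam x.
Proof.
  unfold Gegenbauer. simpl. destruct (gegen_pair lam x n) as [a b]. simpl.
  pose proof (pos_INR n). field. lra.
Qed.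

(** These are n C_n = x C_n' - C_(n-1)' and (n + 2 lam) C_n = C_(n+1)' - x C_n' with each derivative
    C_n' replaced by 2 lam C_(n-1)^(lam+1). They are proved jointly because the induction step of
    each uses the other; the three-term recurrence is the only input. *)
Lemma Gegenbauer_raise (n : nat) (lam x : R) : 0 < lam ->
  (INR n + 2) * Gegenbauer (S (S n)) lam x
    = 2 * lam * (x * Gegenbauer (S n) (lam + 1) x - Gegenbauer n (lam + 1) x) /\
  (INR n + 1 + 2 * lam) * Gegenbauer (S n) lam x
    = 2 * lam * (Gegenbauer (S n) (lam + 1) x - x * Gegenbauer n (lam + 1) x).
Proof.
  intros Hl. induction n as [| n [IH1 IH2]].
  - rewrite Gegenbauer_rec, !Gegenbauer_1, !Gegenbauer_0. simpl. split; ring.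
  - assert (H2 : (INR (S n) + 1 + 2 * lam) * Gegenbauer (S (S n)) lam x
      = 2 * lam * (Gegenbauer (S (S n)) (lam + 1) x - x * Gegenbauer (S n) (lam + 1) x)).
    { pose proof (Gegenbauer_rec n (lam + 1) x) as Hr. rewrite S_INR.
      pose proof (pos_INR n). apply (Rmult_eq_reg_l (INR n + 2)); [| lra].
      transitivity ((INR n + 2 + 2 * lam)
                    * ((INR n + 2) * Gegenbauer (S (S n)) lam x)); [ring |].
      rewrite IH1.
      transitivity (2 * lam * ((INR n + 2) * Gegenbauer (S (S n)) (lam + 1) x
                    - (INR n + 2) * x * Gegenbauer (S n) (lam + 1) x)); [| ring].
      rewrite Hr. ring. }
    split; [| exact H2].
    rewrite (Gegenbauer_rec (S n) lam x). rewrite S_INR in *.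
    transitivity (x * ((INR n + 2) * Gegenbauer (S (S n)) lam x
                       + (INR n + 1 + 1 + 2 * lam) * Gegenbauer (S (S n)) lam x)
                  - (INR n + 1 + 2 * lam) * Gegenbauer (S n) lam x); [ring |].
    rewrite IH1, IH2, H2. ring.
Qed.

(** Adding the two raising relations at the same degree cancels the terms containing x. *)
Lemma Gegenbauer_diff (n : nat) (lam x : R) : 0 < lam ->
  (INR n + 2 + lam) * Gegenbauer (S (S n)) lam x
  = lam * (Gegenbauer (S (S n)) (lam + 1) x - Gegenbauer n (lam + 1) x).
Proof.
  intros Hl. destruct (Gegenbauer_raise n lam x Hl) as [H1 _].
  destruct (Gegenbauer_raise (S n) lam x Hl) as [_ H2].
  rewrite S_INR in H2. nra.
Qed.

(** The second raising relation minus x times the first leaves a single polynomial of parameter lam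
    + 1, with factor 1 - x^2: this is [E]. The remaining x C_(n+1) is removed by the three-term
    recurrence. *)
Lemma Gegenbauer_one_minus_sqr (n : nat) (lam x : R) : 0 < lam ->
  4 * lam * (INR n + lam + 1) * ((1 - x ^ 2) * Gegenbauer n (lam + 1) x)
  = (INR n + 2 * lam) * (INR n + 2 * lam + 1) * Gegenbauer n lam x
    - (INR n + 1) * (INR n + 2) * Gegenbauer (S (S n)) lam x.
Proof.
  intros Hl.
  assert (E : (INR n + 2 * lam) * Gegenbauer n lam x
              - x * (INR n + 1) * Gegenbauer (S n) lam x
              = 2 * lam * ((1 - x ^ 2) * Gegenbauer n (lam + 1) x)).
  { destruct n as [| n]; [rewrite Gegenbauer_1, !Gegenbauer_0; simpl; ring |].
    destruct (Gegenbauer_raise n lam x Hl) as [H1 H2]. rewrite S_INR.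
    transitivity ((INR n + 1 + 2 * lam) * Gegenbauer (S n) lam x
                  - x * ((INR n + 2) * Gegenbauer (S (S n)) lam x)); [ring |].
    rewrite H1, H2. ring. }
  transitivity (2 * (INR n + lam + 1)
                * (2 * lam * ((1 - x ^ 2) * Gegenbauer n (lam + 1) x))); [ring |].
  rewrite <- E.
  transitivity (2 * (INR n + lam + 1) * (INR n + 2 * lam) * Gegenbauer n lam x
    - (INR n + 1) * ((2 * x * (INR n + 1 + lam)) * Gegenbauer (S n) lam x)); [ring |].
  pose proof (Gegenbauer_rec n lam x) as Hr.
  replace (2 * x * (INR n + 1 + lam) * Gegenbauer (S n) lam x)
    with ((INR n + 2) * Gegenbauer (S (S n)) lam x
          + (INR n + 2 * lam) * Gegenbauer n lam x) by lra.
  ring.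
Qed.

(** * Growth classes: exponential growth against factorial decay *)

Definition exp_bounded (a : nat -> R) : Prop :=
  exists K B, 0 <= K /\ 1 <= B /\ forall k, Rabs (a k) <= K * B ^ k.

(** The base B = 1 + p + q satisfies p B + q <= B^2, so a bound on two consecutive terms propagates
    to the next. *)
Lemma exp_bounded_two_step (a : nat -> R) (p q : R) : 0 <= p -> 0 <= q ->
  (forall k, Rabs (a (S (S k))) <= p * Rabs (a (S k)) + q * Rabs (a k)) ->
  exp_bounded a.
Proof.
  intros Hp Hq H. exists (Rabs (a 0%nat) + Rabs (a 1%nat)), (1 + p + q).
  pose proof (Rabs_pos (a 0%nat)). pose proof (Rabs_pos (a 1%nat)).
  split; [lra |]. split; [lra |].
  set (K := Rabs (a 0%nat) + Rabs (a 1%nat)). set (B := 1 + p + q).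
  assert (HK : 0 <= K) by (unfold K; lra). assert (HB : 1 <= B) by (unfold B; lra).
  assert (Hboth : forall k, Rabs (a k) <= K * B ^ k /\ Rabs (a (S k)) <= K * B ^ S k).
  { induction k as [| k [IH1 IH2]].
    - simpl. unfold K, B in *. split; [lra | nra].
    - split; [assumption |]. eapply Rle_trans; [apply H |].
      assert (0 <= K * B ^ k) by (apply Rmult_le_pos; [lra | apply pow_le; lra]).
      simpl in *. replace (K * (B * (B * B ^ k))) with (B * (B * (K * B ^ k))) by ring.
      replace (K * (B * B ^ k)) with (B * (K * B ^ k)) in IH2 by ring.
      revert IH1 IH2 H2. generalize (K * B ^ k). intros v H1' H2' Hv.
      assert (p * Rabs (a (S k)) <= p * (B * v)) by (apply Rmult_le_compat_l; lra).
      assert (q * Rabs (a k) <= q * v) by (apply Rmult_le_compat_l; lra).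
      assert (v <= B * v) by nra.
      assert (q * v <= q * (B * v)) by nra.
      unfold B at 2. nra. }
  intros k. apply Hboth.
Qed.

Lemma exp_bounded_mult (a b : nat -> R) :
  exp_bounded a -> exp_bounded b -> exp_bounded (fun k => a k * b k).
Proof.
  intros (K & B & HK & HB & H) (K' & B' & HK' & HB' & H').
  exists (K * K'), (B * B'). repeat split; [nra | nra |].
  intros k. rewrite Rabs_mult, Rpow_mult_distr.
  replace (K * K' * (B ^ k * B' ^ k)) with (K * B ^ k * (K' * B' ^ k)) by ring.
  apply Rmult_le_compat; auto using Rabs_pos.
Qed.

Lemma exp_bounded_shift (a : nat -> R) :
  exp_bounded a -> exp_bounded (fun k => a (S k)).
Proof.
  intros (K & B & HK & HB & H). exists (K * B), B. repeat split; [nra | assumption |].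
  intros k. eapply Rle_trans; [apply H |]. simpl. lra.
Qed.

Lemma exp_bounded_even (a : nat -> R) :
  exp_bounded a -> exp_bounded (fun k => a (2 * k)%nat).
Proof.
  intros (K & B & HK & HB & H). exists K, (B ^ 2). repeat split; [assumption | nra |].
  intros k. rewrite <- pow_mult. apply H.
Qed.

Lemma exp_bounded_const (c : R) : exp_bounded (fun _ => c).
Proof.
  exists (Rabs c), 1. repeat split; [apply Rabs_pos | lra |].
  intros k. rewrite pow1. lra.
Qed.

Lemma exp_bounded_pow (x : R) : exp_bounded (fun k => x ^ k).
Proof.
  exists 1, (1 + Rabs x). pose proof (Rabs_pos x). repeat split; [lra | lra |].
  intros k. rewrite <- RPow_abs, Rmult_1_l. apply pow_incr. lra.
Qed.

Lemma exp_bounded_linear (r : R) : exp_bounded (fun k => INR k + r).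
Proof.
  exists (1 + Rabs r), 2. pose proof (Rabs_pos r). repeat split; [lra | lra |].
  intros k. assert (Hk : INR k <= 2 ^ k /\ 1 <= 2 ^ k).
  { induction k as [| k IH]; [simpl; lra |]. rewrite S_INR. simpl. lra. }
  pose proof (pos_INR k). eapply Rle_trans; [apply Rabs_triang |].
  rewrite (Rabs_pos_eq (INR k)) by assumption. nra.
Qed.

(** Divided by its leading factor, the three-term recurrence has coefficients bounded uniformly in
    the degree. The resulting crude bound suffices beside factorial decay. *)
Lemma exp_bounded_Gegenbauer (lam w : R) : 0 < lam -> -1 <= w <= 1 ->
  exp_bounded (fun k => Gegenbauer k lam w).
Proof.
  intros Hl Hw. apply (exp_bounded_two_step _ (2 * (1 + lam)) (1 + lam)); [lra | lra |].
  intros k. pose proof (pos_INR k) as Hk. pose proof (Gegenbauer_rec k lam w) as Hr.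
  apply (Rmult_le_reg_l (INR k + 2)); [lra |].
  rewrite <- (Rabs_pos_eq (INR k + 2)) at 1 by lra. rewrite <- Rabs_mult, Hr.
  eapply Rle_trans; [apply Rabs_triang |]. rewrite Rabs_Ropp, !Rabs_mult.
  rewrite (Rabs_pos_eq 2), (Rabs_pos_eq (INR k + 1 + lam)),
    (Rabs_pos_eq (INR k + 2 * lam)) by lra.
  assert (Hw1 : Rabs w <= 1) by (apply Rabs_le; lra).
  pose proof (Rabs_pos w). pose proof (Rabs_pos (Gegenbauer (S k) lam w)).
  pose proof (Rabs_pos (Gegenbauer k lam w)).
  rewrite (Rmult_plus_distr_l (INR k + 2)).
  apply Rplus_le_compat; rewrite <- Rmult_assoc.
  - apply Rmult_le_compat_r; [assumption |].
    assert (Rabs w * (INR k + 1 + lam) <= 1 * (INR k + 1 + lam))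
      by (apply Rmult_le_compat_r; lra). nra.
  - apply Rmult_le_compat_r; [assumption |]. nra.
Qed.

Definition fact_bounded (b : nat -> R) : Prop :=
  exists K B, 0 <= K /\ 1 <= B /\ forall k, Rabs (b k) <= K * (B ^ k / INR (fact k)).

Lemma fact_bounded_mult (a b : nat -> R) :
  exp_bounded a -> fact_bounded b -> fact_bounded (fun k => a k * b k).
Proof.
  intros (K & B & HK & HB & H) (K' & B' & HK' & HB' & H').
  exists (K * K'), (B * B'). repeat split; [nra | nra |].
  intros k. rewrite Rabs_mult, Rpow_mult_distr.
  replace (K * K' * (B ^ k * B' ^ k / INR (fact k)))
    with (K * B ^ k * (K' * (B' ^ k / INR (fact k)))) by (unfold Rdiv; ring).
  apply Rmult_le_compat; auto using Rabs_pos.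
Qed.

Lemma is_series_exp (y : R) : is_series (fun n => y ^ n / INR (fact n)) (exp y).
Proof.
  apply (is_series_ext (fun n => / INR (fact n) * y ^ n)).
  - intros n. unfold Rdiv. apply Rmult_comm.
  - apply is_pseries_R, is_exp_Reals.
Qed.

Lemma ex_series_le_R (a b : nat -> R) :
  (forall k, Rabs (a k) <= b k) -> ex_series b -> ex_series a.
Proof. apply (ex_series_le (V := R_CompleteNormedModule)). Qed.

Lemma ex_series_fact_bounded (b : nat -> R) : fact_bounded b -> ex_series b.
Proof.
  intros (K & B & HK & HB & H). apply (ex_series_le_R _ _ H).
  apply (ex_series_scal_l (V := R_NormedModule) K). eexists. apply is_series_exp.
Qed.

(** * Bessel series: estimates in the order and the three-term recurrence *)

Definition bessel_term (nu z : R) (n : nat) : R :=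
  (-1) ^ n / (INR (fact n) * Gamma (INR n + nu + 1)) * (z / 2) ^ (2 * n).

(* The entire function [(z/2)^(-nu) J_nu(z)]. *)
Definition bessel_series (nu z : R) : R := Series (bessel_term nu z).

(** Each unit step gains nu + p + 1 >= (p + 1) / 2, whence the power of 2. The bound -1/2 admits the
    order lam - 1 at lam = 1/2, the lowest one that occurs. *)
Lemma Gamma_lower_bound (nu : R) (p : nat) : - / 2 <= nu ->
  Gamma (nu + 1) * INR (fact p) <= 2 ^ p * Gamma (INR p + nu + 1).
Proof.
  intros Hnu. assert (HG : 0 < Gamma (nu + 1)) by (apply Gamma_pos; lra).
  induction p as [| p IH].
  - simpl. replace (0 + nu + 1) with (nu + 1) by ring. lra.
  - rewrite fact_simpl, mult_INR, S_INR. pose proof (pos_INR p).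
    replace (INR p + 1 + nu + 1) with (INR p + nu + 1 + 1) by ring.
    rewrite (Gamma_S (INR p + nu + 1)) by lra. simpl. pose proof (INR_fact_lt_0 p).
    assert (0 < Gamma (nu + 1) * INR (fact p)) by (apply Rmult_lt_0_compat; lra).
    apply Rle_trans with ((INR p + 1) * (2 ^ p * Gamma (INR p + nu + 1))).
    + replace (Gamma (nu + 1) * ((INR p + 1) * INR (fact p)))
        with ((INR p + 1) * (Gamma (nu + 1) * INR (fact p))) by ring.
      apply Rmult_le_compat_l; lra.
    + replace (2 * 2 ^ p * ((INR p + nu + 1) * Gamma (INR p + nu + 1)))
        with (2 * (INR p + nu + 1) * (2 ^ p * Gamma (INR p + nu + 1))) by ring.
      apply Rmult_le_compat_r; lra.
Qed.

Lemma Gamma_inv_bound (nu : R) (p : nat) : - / 2 <= nu ->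
  0 < / Gamma (INR p + nu + 1) <= / Gamma (nu + 1) * (2 ^ p / INR (fact p)).
Proof.
  intros Hnu. pose proof (Gamma_lower_bound nu p Hnu) as H.
  pose proof (pos_INR p). pose proof (INR_fact_lt_0 p).
  assert (HG1 : 0 < Gamma (nu + 1)) by (apply Gamma_pos; lra).
  assert (HG2 : 0 < Gamma (INR p + nu + 1)) by (apply Gamma_pos; lra).
  split; [now apply Rinv_0_lt_compat |].
  apply (Rmult_le_reg_r (Gamma (INR p + nu + 1) * (Gamma (nu + 1) * INR (fact p)))).
  - apply Rmult_lt_0_compat; [| apply Rmult_lt_0_compat]; assumption.
  - replace (/ Gamma (INR p + nu + 1) * (Gamma (INR p + nu + 1) * (Gamma (nu + 1) * INR (fact p))))
      with (Gamma (nu + 1) * INR (fact p)) by (field; lra).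
    replace (/ Gamma (nu + 1) * (2 ^ p / INR (fact p))
             * (Gamma (INR p + nu + 1) * (Gamma (nu + 1) * INR (fact p))))
      with (2 ^ p * Gamma (INR p + nu + 1)) by (field; lra).
    assumption.
Qed.

(** Gamma at n + k + nu + 1 is bounded below through (n + k)! >= k!, while n! is already present in
    the term. The bound is thus a product of a factor in k and a factor in n, which gives both
    summability in n and factorial decay in k. *)
Lemma bessel_term_bound (nu z : R) (k n : nat) : - / 2 <= nu ->
  Rabs (bessel_term (INR k + nu) z n)
  <= / Gamma (nu + 1) * (2 ^ k / INR (fact k)) * ((2 * (z / 2) ^ 2) ^ n / INR (fact n)).
Proof.
  intros Hnu. unfold bessel_term.
  replace (INR n + (INR k + nu) + 1) with (INR (n + k) + nu + 1) by (rewrite plus_INR; ring).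
  destruct (Gamma_inv_bound nu (n + k) Hnu) as [HG0 HG].
  pose proof (INR_fact_lt_0 n). pose proof (INR_fact_lt_0 k).
  assert (Hy : 0 <= (z / 2) ^ 2) by nra.
  rewrite pow_mult, Rabs_mult, (Rabs_pos_eq (((z / 2) ^ 2) ^ n)) by now apply pow_le.
  unfold Rdiv at 1. rewrite Rabs_mult, pow_1_abs, Rmult_1_l.
  rewrite Rinv_mult, Rabs_pos_eq
    by (apply Rmult_le_pos; [left; now apply Rinv_0_lt_compat | lra]).
  apply Rle_trans with (/ INR (fact n) * (/ Gamma (nu + 1) * (2 ^ (n + k) / INR (fact k)))
                        * ((z / 2) ^ 2) ^ n).
  - apply Rmult_le_compat_r; [now apply pow_le |].
    apply Rmult_le_compat_l; [left; now apply Rinv_0_lt_compat |].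
    eapply Rle_trans; [exact HG |].
    apply Rmult_le_compat_l; [left; apply Rinv_0_lt_compat, Gamma_pos; lra |].
    apply Rmult_le_compat_l; [apply pow_le; lra |].
    apply Rinv_le_contravar; [assumption |]. apply le_INR, fact_le. lia.
  - right. rewrite pow_add, (Rpow_mult_distr 2). field.
    repeat split; try lra. apply Rgt_not_eq, Gamma_pos. lra.
Qed.

Lemma ex_series_bessel (nu z : R) : - / 2 <= nu -> ex_series (bessel_term nu z).
Proof.
  intros Hnu.
  apply (ex_series_le_R _ (fun n => / Gamma (nu + 1) * (2 ^ 0 / INR (fact 0))
           * ((2 * (z / 2) ^ 2) ^ n / INR (fact n)))).
  - intros n. pose proof (bessel_term_bound nu z 0 n Hnu) as H.
    simpl (INR 0) in H. now rewrite Rplus_0_l in H.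
  - apply (ex_series_scal_l (V := R_NormedModule)). eexists. apply is_series_exp.
Qed.

Lemma fact_bounded_bessel (nu z : R) : - / 2 <= nu ->
  fact_bounded (fun k => bessel_series (INR k + nu) z).
Proof.
  intros Hnu. exists (/ Gamma (nu + 1) * exp (2 * (z / 2) ^ 2)), 2.
  assert (HG : 0 < / Gamma (nu + 1)) by (apply Rinv_0_lt_compat, Gamma_pos; lra).
  pose proof (exp_pos (2 * (z / 2) ^ 2)).
  repeat split; [nra | lra |]. intros k. unfold bessel_series.
  set (C := / Gamma (nu + 1) * (2 ^ k / INR (fact k))).
  assert (Hs : is_series (fun n => C * ((2 * (z / 2) ^ 2) ^ n / INR (fact n)))
                 (C * exp (2 * (z / 2) ^ 2))).
  { apply (is_series_scal_l (V := R_NormedModule) C). apply is_series_exp. }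
  assert (Habs : ex_series (fun n => Rabs (bessel_term (INR k + nu) z n))).
  { apply (ex_series_le_R _ (fun n => C * ((2 * (z / 2) ^ 2) ^ n / INR (fact n)))).
    - intros n. rewrite Rabs_Rabsolu. now apply bessel_term_bound.
    - eexists. exact Hs. }
  eapply Rle_trans; [now apply Series_Rabs |].
  replace (/ Gamma (nu + 1) * exp (2 * (z / 2) ^ 2) * (2 ^ k / INR (fact k)))
    with (C * exp (2 * (z / 2) ^ 2)) by (unfold C; ring).
  rewrite <- (is_series_unique _ _ Hs). apply Series_le.
  - intros n. split; [apply Rabs_pos | now apply bessel_term_bound].
  - eexists. exact Hs.
Qed.

(** This is (2 nu / z) J_nu = J_(nu-1) + J_(nu+1) after normalization. The coefficients are compared
    with the constant term split off, since the last series enters shifted by one power of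
    (z/2)^2. *)
Lemma bessel_series_rec (nu z : R) : / 2 <= nu ->
  nu * bessel_series nu z
  = bessel_series (nu - 1) z + (z / 2) ^ 2 * bessel_series (nu + 1) z.
Proof.
  intros Hnu. unfold bessel_series.
  rewrite <- !Series_scal_l.
  rewrite (Series_incr_1 (fun n => nu * bessel_term nu z n))
    by (apply (ex_series_scal_l (V := R_NormedModule)); apply ex_series_bessel; lra).
  rewrite (Series_incr_1 (bessel_term (nu - 1) z)) by (apply ex_series_bessel; lra).
  rewrite Rplus_assoc, <- Series_plus.
  - f_equal.
    + unfold bessel_term. simpl.
      replace (0 + nu + 1) with (nu + 1) by ring.
      replace (0 + (nu - 1) + 1) with nu by ring.
      rewrite Gamma_S by lra. field. split; [apply Rgt_not_eq, Gamma_pos |]; lra.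
    + apply Series_ext. intros n. unfold bessel_term.
      rewrite fact_simpl, mult_INR, !S_INR. pose proof (pos_INR n).
      replace (INR n + (nu + 1) + 1) with (INR n + nu + 1 + 1) by ring.
      replace (INR n + 1 + (nu - 1) + 1) with (INR n + nu + 1) by ring.
      replace (INR n + 1 + nu + 1) with (INR n + nu + 1 + 1) by ring.
      rewrite Gamma_S by lra.
      replace (2 * S n)%nat with (2 * n + 2)%nat by lia. rewrite pow_add.
      simpl ((-1) ^ S n). pose proof (INR_fact_lt_0 n).
      field. repeat split; try lra. apply Rgt_not_eq, Gamma_pos; lra.
  - apply (ex_series_incr_1 (bessel_term (nu - 1) z)), ex_series_bessel. lra.
  - apply (ex_series_scal_l (V := R_NormedModule)). apply ex_series_bessel. lra.
Qed.

(** * The induction step *)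

(** Encodes the index k - 1 with the convention that the term of index -1 is 0, so that reindexing a
    series changes neither its sum nor its starting index. *)
Definition right_shift (a : nat -> R) (k : nat) : R :=
  match k with O => 0 | S j => a j end.

Lemma is_series_shift (a : nat -> R) (l : R) : is_series a l -> is_series (right_shift a) l.
Proof.
  intros H. apply (is_series_decr_1 (V := R_NormedModule)). simpl.
  unfold plus, opp; simpl. now rewrite Ropp_0, Rplus_0_r.
Qed.

Lemma is_series_ext_R (a b : nat -> R) (l : R) :
  (forall k, a k = b k) -> is_series a l -> is_series b l.
Proof. apply (is_series_ext (V := R_NormedModule)). Qed.

Lemma is_series_plus_R (a b : nat -> R) (la lb : R) :
  is_series a la -> is_series b lb -> is_series (fun k => a k + b k) (la + lb).
Proof. apply (is_series_plus (V := R_NormedModule)). Qed.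

Lemma is_series_scal_R (c : R) (a : nat -> R) (l : R) :
  is_series a l -> is_series (fun k => c * a k) (c * l).
Proof. apply (is_series_scal_l (V := R_NormedModule)). Qed.

Lemma is_series_minus_R (a b : nat -> R) (la lb : R) :
  is_series a la -> is_series b lb -> is_series (fun k => a k - b k) (la - lb).
Proof. apply (is_series_minus (V := R_NormedModule)). Qed.

Lemma ex_series_bessel_combination (a : nat -> R) (nu z : R) : - / 2 <= nu ->
  exp_bounded a -> ex_series (fun k => a k * bessel_series (INR k + nu) z).
Proof.
  intros Hnu Ha. apply ex_series_fact_bounded.
  exact (fact_bounded_mult _ _ Ha (fact_bounded_bessel nu z Hnu)).
Qed.

Definition bessel_gegenbauer (lam z w : R) (k : nat) : R :=
  bessel_series (INR k + lam) z * (z / 2) ^ k * Gegenbauer k lam w.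

(* Multiplying by [z * w] uses the three-term recurrence of the Gegenbauer polynomials, and
   the target series is split by the three-term recurrence of the Bessel functions; after
   shifting indices the coefficients of each [Gegenbauer k lam w] agree. *)
Lemma is_series_bessel_gegenbauer_step (lam z w : R) (c d u : nat -> R) (l1 l2 : R) :
  / 2 <= lam -> -1 <= w <= 1 -> exp_bounded c -> exp_bounded d ->
  u 0%nat = d 0%nat ->
  (forall k, u (S k) = (INR k + 1) * c k + d (S k)) ->
  (forall k, u k = (INR k + 2 * lam) * c (S k) - d (S (S k))) ->
  is_series (fun k => c k * ((INR k + lam) * bessel_gegenbauer lam z w k)) l1 ->
  is_series (fun k => d k * (bessel_series (INR k + (lam - 1)) z * (z / 2) ^ k
      * (Gegenbauer k lam w - right_shift (right_shift (fun j => Gegenbauer j lam w)) k))) l2 ->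
  is_series (fun k => u k * ((INR k + lam) * bessel_gegenbauer lam z w k))
    (z * w * l1 + l2).
Proof.
  intros Hl Hw Hc Hd Hu0 Hu1 Hu2 H1 H2.
  set (C := fun k => Gegenbauer k lam w) in *.
  set (F := fun nu => bessel_series nu z).
  assert (HC : exp_bounded C) by (apply exp_bounded_Gegenbauer; lra).
  (* Relative to deg + lam, where deg is the Gegenbauer degree, [TA] and [TD] carry the Bessel order
     one below, [TB] and [TE] the order one above. All but [TA] are indexed by that degree. *)
  set (TA := fun k => c k * (z / 2) ^ S k * (INR k + 1) * C (S k) * F (INR k + lam)).
  set (TB := fun k => c (S k) * (z / 2) ^ S (S k) * (INR k + 2 * lam) * C k
                      * F (INR k + (lam + 1))).
  set (TD := fun k => d k * (z / 2) ^ k * C k * F (INR k + (lam - 1))).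
  set (TE := fun k => d (S (S k)) * (z / 2) ^ S (S k) * C k * F (INR k + (lam + 1))).
  pose proof (exp_bounded_pow (z / 2)) as Hx.
  pose proof (exp_bounded_shift _ Hx) as Hx1. pose proof (exp_bounded_shift _ Hx1) as Hx2.
  pose proof (exp_bounded_shift _ HC) as HC1. pose proof (exp_bounded_shift _ Hc) as Hc1.
  pose proof (exp_bounded_shift _ (exp_bounded_shift _ Hd)) as Hd2.
  assert (HTA : ex_series TA).
  { apply (ex_series_bessel_combination
      (fun k => c k * (z / 2) ^ S k * (INR k + 1) * C (S k)) lam); [lra |].
    exact (exp_bounded_mult _ _ (exp_bounded_mult _ _ (exp_bounded_mult _ _ Hc Hx1)
             (exp_bounded_linear 1)) HC1). }
  assert (HTB : ex_series TB).
  { apply (ex_series_bessel_combination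
      (fun k => c (S k) * (z / 2) ^ S (S k) * (INR k + 2 * lam) * C k) (lam + 1)); [lra |].
    exact (exp_bounded_mult _ _ (exp_bounded_mult _ _ (exp_bounded_mult _ _ Hc1 Hx2)
             (exp_bounded_linear (2 * lam))) HC). }
  assert (HTD : ex_series TD).
  { apply (ex_series_bessel_combination
      (fun k => d k * (z / 2) ^ k * C k) (lam - 1)); [lra |].
    exact (exp_bounded_mult _ _ (exp_bounded_mult _ _ Hd Hx) HC). }
  assert (HTE : ex_series TE).
  { apply (ex_series_bessel_combination
      (fun k => d (S (S k)) * (z / 2) ^ S (S k) * C k) (lam + 1)); [lra |].
    exact (exp_bounded_mult _ _ (exp_bounded_mult _ _ Hd2 Hx2) HC). }
  destruct HTA as [sA HA], HTB as [sB HB], HTD as [sD HD], HTE as [sE HE].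
  assert (E1 : z * w * l1 = sA + sB).
  { rewrite <- (is_series_unique _ _ (is_series_scal_R (z * w) _ _ H1)).
    apply is_series_unique.
    apply (is_series_ext_R (fun k => TA k + right_shift TB k));
      [| now apply is_series_plus_R, is_series_shift].
    intros k. unfold bessel_gegenbauer, TA, TB, right_shift. fold (F (INR k + lam)).
    destruct k as [| k].
    - unfold C. rewrite Gegenbauer_0, Gegenbauer_1. simpl. field.
    - fold (C (S k)). pose proof (Gegenbauer_rec k lam w) as Hr.
      fold (C (S (S k))) in Hr. fold (C (S k)) in Hr. fold (C k) in Hr.
      replace (INR k + (lam + 1)) with (INR (S k) + lam) by (rewrite S_INR; ring).
      rewrite S_INR in *. simpl ((z / 2) ^ S (S k)).
      transitivity (c (S k) * ((z / 2) * (z / 2) ^ S k) * F (INR k + 1 + lam) *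
        ((INR k + 2) * C (S (S k)) + (INR k + 2 * lam) * C k)).
      + simpl. ring.
      + rewrite Hr. simpl. field. }
  assert (E2 : l2 = sD - sE).
  { rewrite <- (is_series_unique _ _ H2). apply is_series_unique.
    apply (is_series_ext_R (fun k => TD k - right_shift (right_shift TE) k));
      [| now apply is_series_minus_R, is_series_shift, is_series_shift].
    intros k. unfold TD, TE, right_shift. fold (C k). fold (F (INR k + (lam - 1))).
    destruct k as [| [| k]]; [ring | ring |].
    replace (INR k + (lam + 1)) with (INR (S (S k)) + (lam - 1)) by (rewrite !S_INR; ring).
    fold (C k). ring. }
  replace (z * w * l1 + l2) with (sA + sD + (sB - sE)) by lra.
  apply (is_series_ext_R (fun k => right_shift TA k + TD k + (TB k - TE k))).
  - intros k. unfold bessel_gegenbauer.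
    pose proof (bessel_series_rec (INR k + lam) z) as Hb.
    assert (Hk : / 2 <= INR k + lam) by (pose proof (pos_INR k); lra).
    transitivity (u k * (z / 2) ^ k * C k * F (INR k + (lam - 1))
                  + u k * (z / 2) ^ S (S k) * C k * F (INR k + (lam + 1))).
    (* The same coefficient [u k] is expanded in two ways: by [Hu2] at the upper Bessel order, and
       by [Hu0] or [Hu1] at the lower one. *)
    + rewrite (Hu2 k) at 2. unfold TB, TD, TE.
      destruct k as [| k].
      * rewrite Hu0. unfold right_shift. ring.
      * rewrite Hu1. unfold right_shift, TA.
        replace (INR (S k) + (lam - 1)) with (INR k + lam) by (rewrite S_INR; ring). ring.
    + transitivity (u k * (z / 2) ^ k * C k * ((INR k + lam) * F (INR k + lam))).
      * unfold F. rewrite (Hb Hk).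
        replace (INR k + (lam - 1)) with (INR k + lam - 1) by ring.
        replace (INR k + (lam + 1)) with (INR k + lam + 1) by ring.
        simpl. ring.
      * unfold C, F. ring.
  - apply is_series_plus_R; [apply is_series_plus_R |].
    + now apply is_series_shift.
    + assumption.
    + now apply is_series_minus_R.
Qed.

(** * Double factorials and the expansion coefficients *)

Lemma dfact_nat_SS (n : nat) : dfact_nat (S (S n)) = (S (S n) * dfact_nat n)%nat.
Proof. reflexivity. Qed.

(* With truncated subtraction this also covers [(-1)!! = 1] at [n = 0]. *)
Lemma dfact_nat_pred (n : nat) : dfact_nat (S (S n) - 1) = (S n * dfact_nat (n - 1))%nat.
Proof.
  destruct n as [| n]; [reflexivity |].
  replace (S (S (S n)) - 1)%nat with (S (S n)) by lia.
  replace (S n - 1)%nat with n by lia. apply dfact_nat_SS.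
Qed.

Lemma dfact_nat_pos (n : nat) : (0 < dfact_nat n)%nat.
Proof.
  enough (H : (0 < dfact_nat n /\ 0 < dfact_nat (S n))%nat) by apply H.
  induction n as [| n [IH1 IH2]]; [simpl; lia |]. rewrite dfact_nat_SS. lia.
Qed.

Lemma INR_dfact_nat_pos (n : nat) : 0 < INR (dfact_nat n).
Proof. apply lt_0_INR, dfact_nat_pos. Qed.

Lemma dfact_nat_double (n : nat) : dfact_nat (2 * n) = (2 ^ n * fact n)%nat.
Proof.
  induction n as [| n IH]; [reflexivity |].
  replace (2 * S n)%nat with (S (S (2 * n))) by lia.
  rewrite dfact_nat_SS, IH, fact_simpl, Nat.pow_succ_r'. ring.
Qed.

(* The coefficient for dimension [m = 2 * a + 1]. *)
Definition expansion_coeff (a i k : nat) : R :=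
  if Nat.even (k + i)
  then INR (dfact_nat (k + i - 1)) / INR (dfact_nat (k + 2 * a - i)) else 0.

Lemma expansion_coeff_even (a i k : nat) : Nat.even (k + i) = true ->
  expansion_coeff a i k
  = INR (dfact_nat (k + i - 1)) / INR (dfact_nat (k + 2 * a - i)).
Proof. intros H. unfold expansion_coeff. now rewrite H. Qed.

Lemma expansion_coeff_odd (a i k : nat) : Nat.even (k + i) = false ->
  expansion_coeff a i k = 0.
Proof. intros H. unfold expansion_coeff. now rewrite H. Qed.

(** When k grows by two, numerator and denominator each gain one factor, and the quotient of these
    factors is at most i + 1. *)
Lemma exp_bounded_expansion_coeff (a i : nat) : (i <= 2 * a + 1)%nat ->
  exp_bounded (expansion_coeff a i).
Proof.
  intros Hi. pose proof (pos_INR i) as HI.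
  apply (exp_bounded_two_step _ 0 (INR i + 1)); [lra | lra |].
  intros k. rewrite Rmult_0_l, Rplus_0_l. unfold expansion_coeff.
  change (Nat.even (S (S k) + i)) with (Nat.even (k + i)).
  destruct (Nat.even (k + i)) eqn:Ek; [| rewrite Rabs_R0; lra].
  (* Parity excludes i = k + 2 a + 1, the one case in which the natural subtraction in the
     denominator would truncate. *)
  assert (Hpos : (i <= k + 2 * a)%nat).
  { destruct (Nat.eq_dec i (k + 2 * a + 1)) as [-> | H]; [| lia].
    replace (k + (k + 2 * a + 1))%nat with (S (2 * (k + a))) in Ek by lia.
    rewrite Nat.even_succ, Nat.odd_mul, Nat.odd_2 in Ek. discriminate. }
  replace (S (S k) + i - 1)%nat with (S (S (k + i)) - 1)%nat by lia.
  replace (S (S k) + 2 * a - i)%nat with (S (S (k + 2 * a - i))) by lia.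
  rewrite dfact_nat_pred, dfact_nat_SS, !mult_INR, !S_INR, plus_INR.
  pose proof (INR_dfact_nat_pos (k + i - 1)) as H1.
  pose proof (INR_dfact_nat_pos (k + 2 * a - i)) as H2.
  pose proof (pos_INR (k + 2 * a - i)) as H3. pose proof (pos_INR k) as Hk.
  assert (H4 : INR k <= INR (k + 2 * a - i) + 1).
  { rewrite <- S_INR. apply le_INR. lia. }
  set (p := INR (dfact_nat (k + i - 1))) in *.
  set (q := INR (dfact_nat (k + 2 * a - i))) in *.
  set (r := INR (k + 2 * a - i)) in *.
  rewrite !Rabs_pos_eq
    by (apply Rlt_le, Rdiv_lt_0_compat; try assumption;
        apply Rmult_lt_0_compat; lra).
  replace ((INR k + INR i + 1) * p / ((r + 1 + 1) * q))
    with ((INR k + INR i + 1) / (r + 2) * (p / q)) by (field; lra).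
  apply Rmult_le_compat_r; [apply Rlt_le, Rdiv_lt_0_compat; assumption |].
  apply Rle_div_l; [lra |]. nra.
Qed.

(** All three quotients have the same denominator; the extra factor of the left numerator is k + i +
    2 = (k + 1) + (i + 1). *)
Lemma expansion_coeff_raise (a i k : nat) : (i <= 2 * a + 2)%nat ->
  expansion_coeff (S a) (S (S i)) (S k)
  = (INR k + 1) * expansion_coeff (S a) (S i) k
    + INR (S i) * expansion_coeff a i (S k).
Proof.
  intros Hi. unfold expansion_coeff.
  replace (S k + S (S i))%nat with (S (S (S k + i))) by lia.
  replace (k + S i)%nat with (S k + i)%nat by lia.
  change (Nat.even (S (S (S k + i)))) with (Nat.even (S k + i)).
  destruct (Nat.even (S k + i)); [| ring].
  rewrite dfact_nat_pred, mult_INR.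
  replace (S k + 2 * S a - S (S i))%nat with (S k + 2 * a - i)%nat by lia.
  replace (k + 2 * S a - S i)%nat with (S k + 2 * a - i)%nat by lia.
  replace (INR (S (S k + i))) with (INR k + 1 + INR (S i))
    by (rewrite !S_INR, plus_INR, S_INR; ring).
  field. apply Rgt_not_eq, INR_dfact_nat_pos.
Qed.

Lemma expansion_coeff_0 (a i : nat) : (i <= 2 * a + 1)%nat ->
  expansion_coeff (S a) (S (S i)) 0 = INR (S i) * expansion_coeff a i 0.
Proof.
  intros Hi. unfold expansion_coeff.
  change (Nat.even (0 + S (S i))) with (Nat.even (0 + i)).
  destruct (Nat.even (0 + i)); [| ring].
  change (0 + S (S i))%nat with (S (S i)). change (0 + i)%nat with i.
  rewrite dfact_nat_pred, mult_INR.
  replace (0 + 2 * S a - S (S i))%nat with (0 + 2 * a - i)%nat by lia.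
  field. apply Rgt_not_eq, INR_dfact_nat_pos.
Qed.

(** Here the numerators agree; the extra factor of both denominators on the right is k + 2 a - i + 2
    = (k + 2 a + 3) - (i + 1). *)
Lemma expansion_coeff_lower (a i k : nat) : (i <= 2 * a + 1)%nat ->
  expansion_coeff (S a) (S (S i)) k
  = (INR k + 2 * INR a + 3) * expansion_coeff (S a) (S i) (S k)
    - INR (S i) * expansion_coeff a i (S (S k)).
Proof.
  intros Hi. unfold expansion_coeff.
  replace (k + S (S i))%nat with (S (S (k + i))) by lia.
  replace (S k + S i)%nat with (S (S (k + i))) by lia.
  replace (S (S k) + i)%nat with (S (S (k + i))) by lia.
  destruct (Nat.even (S (S (k + i)))) eqn:Ek; [| ring].
  assert (Hpos : (i <= k + 2 * a)%nat).
  { destruct (Nat.eq_dec i (k + 2 * a + 1)) as [-> | H]; [| lia].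
    change (Nat.even (k + (k + 2 * a + 1)) = true) in Ek.
    replace (k + (k + 2 * a + 1))%nat with (S (2 * (k + a))) in Ek by lia.
    rewrite Nat.even_succ, Nat.odd_mul, Nat.odd_2 in Ek. discriminate. }
  replace (S k + 2 * S a - S i)%nat with (S (S (k + 2 * a - i))) by lia.
  replace (S (S k) + 2 * a - i)%nat with (S (S (k + 2 * a - i))) by lia.
  replace (k + 2 * S a - S (S i))%nat with (k + 2 * a - i)%nat by lia.
  rewrite (dfact_nat_SS (k + 2 * a - i)), mult_INR.
  replace (INR (S (S (k + 2 * a - i)))) with (INR k + 2 * INR a - INR i + 2)
    by (rewrite !S_INR, minus_INR, plus_INR, mult_INR by lia; simpl; ring).
  rewrite S_INR. pose proof (INR_dfact_nat_pos (k + 2 * a - i)).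
  assert (INR i <= INR k + 2 * INR a).
  { replace (2 * INR a) with (INR (2 * a)) by (rewrite mult_INR; simpl; ring).
    rewrite <- plus_INR. now apply le_INR. }
  field. lra.
Qed.

Lemma expansion_coeff_1_S (a k : nat) :
  expansion_coeff a 1 (S k) = (INR k + 1) * expansion_coeff a 0 k.
Proof.
  unfold expansion_coeff.
  replace (S k + 1)%nat with (S (S k)) by lia. replace (k + 0)%nat with k by lia.
  change (Nat.even (S (S k))) with (Nat.even k). destruct (Nat.even k); [| ring].
  rewrite dfact_nat_pred, mult_INR, S_INR.
  replace (S k + 2 * a - 1)%nat with (k + 2 * a - 0)%nat by lia.
  field. apply Rgt_not_eq, INR_dfact_nat_pos.
Qed.

Lemma expansion_coeff_1 (a k : nat) :
  expansion_coeff a 1 k = (INR k + 2 * INR a + 1) * expansion_coeff a 0 (S k).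
Proof.
  unfold expansion_coeff.
  replace (k + 1)%nat with (S k) by lia. replace (S k + 0)%nat with (S k) by lia.
  destruct (Nat.even (S k)) eqn:Ek; [| ring].
  destruct k as [| k]; [discriminate |].
  replace (S (S k) + 2 * a - 0)%nat with (S (S (k + 2 * a))) by lia.
  replace (S k + 2 * a - 1)%nat with (k + 2 * a)%nat by lia.
  rewrite (dfact_nat_SS (k + 2 * a)), mult_INR, !S_INR, plus_INR, mult_INR.
  pose proof (INR_dfact_nat_pos (k + 2 * a)). pose proof (pos_INR k). pose proof (pos_INR a).
  simpl (INR 2). field. lra.
Qed.

(** Extends [Gegenbauer_diff] to degrees 0 and 1, with polynomials of negative degree read as 0. It
    re-expands the series for m - 2 in the polynomials belonging to m. *)
Lemma Gegenbauer_shift_diff (k : nat) (lam x : R) : 0 < lam ->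
  (INR k + lam) * Gegenbauer k lam x
  = lam * (Gegenbauer k (lam + 1) x
           - right_shift (right_shift (fun j => Gegenbauer j (lam + 1) x)) k).
Proof.
  intros Hl. destruct k as [| [| k]].
  - rewrite !Gegenbauer_0. simpl. ring.
  - rewrite !Gegenbauer_1. simpl. ring.
  - simpl right_shift. rewrite <- Gegenbauer_diff by assumption. rewrite !S_INR. ring.
Qed.

(** * The case [i = 0] *)

(** The value 0 for j > q is the usual convention for the reciprocal of the factorial of a negative
    integer; it lets sums run past q. *)
Definition inv_fact_sub (q j : nat) : R :=
  if (j <=? q)%nat then / INR (fact (q - j)) else 0.

Lemma inv_fact_sub_le (q j : nat) : (j <= q)%nat ->
  inv_fact_sub q j = / INR (fact (q - j)).
Proof. intros H. unfold inv_fact_sub. now apply Nat.leb_le in H as ->. Qed.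

Lemma inv_fact_sub_gt (q j : nat) : (q < j)%nat -> inv_fact_sub q j = 0.
Proof. intros H. unfold inv_fact_sub. now apply Nat.leb_gt in H as ->. Qed.

(** The boundary j = q + 1, where both sides vanish, is included, so the top coefficient in the step
    from q to q + 1 is no special case. *)
Lemma inv_fact_sub_S (q j : nat) : (j <= S q)%nat ->
  inv_fact_sub q j = (INR q + 1 - INR j) * inv_fact_sub (S q) j.
Proof.
  intros H. rewrite (inv_fact_sub_le (S q)) by assumption.
  destruct (Nat.eq_dec j (S q)) as [-> | Hne].
  - rewrite inv_fact_sub_gt by lia. rewrite S_INR. ring.
  - rewrite inv_fact_sub_le by lia. replace (S q - j)%nat with (S (q - j)) by lia.
    rewrite fact_simpl, mult_INR, S_INR, minus_INR by lia.
    pose proof (INR_fact_lt_0 (q - j)).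
    assert (INR j <= INR q) by (apply le_INR; lia). field. lra.
Qed.

Lemma inv_fact_sub_SS (q j : nat) : inv_fact_sub (S q) (S j) = inv_fact_sub q j.
Proof. reflexivity. Qed.

(** The Gegenbauer parameter lam = m / 2 for m = 2 a + 1. *)
Definition half_odd (a : nat) : R := INR a + / 2.

Lemma half_odd_S (a : nat) : half_odd (S a) = half_odd a + 1.
Proof. unfold half_odd. rewrite S_INR. ring. Qed.

Lemma half_odd_ge (a : nat) : / 2 <= half_odd a.
Proof. unfold half_odd. pose proof (pos_INR a). lra. Qed.

(** Obtained by collecting (z/2)^(2q) in the series to be proved for i = 0: the term of index q - j
    in the Bessel series of order 2 j + lam contributes, with the common sign (-1)^q factored
    out. *)
Definition sin_pow_coeff (a q j : nat) : R :=
  expansion_coeff a 0 (2 * j) * (2 * INR j + half_odd a) * Gamma (half_odd a)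
  * (-1) ^ j * inv_fact_sub q j / Gamma (INR q + INR j + half_odd a + 1).

Lemma expansion_coeff_S_0_double (a j : nat) :
  (2 * INR j + 2 * INR a + 2) * expansion_coeff (S a) 0 (2 * j) = expansion_coeff a 0 (2 * j).
Proof.
  rewrite !expansion_coeff_even
    by (rewrite Nat.add_0_r, Nat.even_mul; reflexivity).
  replace (2 * j + 2 * S a - 0)%nat with (S (S (2 * j + 2 * a))) by lia.
  replace (2 * j + 2 * a - 0)%nat with (2 * j + 2 * a)%nat by lia.
  rewrite dfact_nat_SS, mult_INR, !S_INR, plus_INR, !mult_INR.
  pose proof (INR_dfact_nat_pos (2 * j + 2 * a)). pose proof (pos_INR j).
  pose proof (pos_INR a). simpl (INR 2). field. lra.
Qed.

Lemma expansion_coeff_0_double_S (a j : nat) :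
  expansion_coeff a 0 (2 * S j) = (2 * INR j + 1) * expansion_coeff (S a) 0 (2 * j).
Proof.
  rewrite !expansion_coeff_even
    by (rewrite Nat.add_0_r, Nat.even_mul; reflexivity).
  replace (2 * S j + 0 - 1)%nat with (S (S (2 * j + 0)) - 1)%nat by lia.
  rewrite dfact_nat_pred, mult_INR, S_INR, plus_INR, mult_INR.
  replace (2 * S j + 2 * a - 0)%nat with (2 * j + 2 * S a - 0)%nat by lia.
  simpl (INR 2). simpl (INR 0). field. apply Rgt_not_eq, INR_dfact_nat_pos.
Qed.

(** Equality of the coefficients of C_(2j+2)^lam when the expansion for (q, lam + 1) is multiplied
    by 1 - x^2: the polynomials of degrees 2 j + 2 and 2 j both contribute. The factors q + 1 and 2
    compare the normalizations (q+1)! 2^a and q! 2^(a+1). *)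
Lemma sin_pow_coeff_S_pred (a q j : nat) : (j <= q)%nat ->
  (INR q + 1) * sin_pow_coeff a (S q) (S j)
  = 2 * (sin_pow_coeff (S a) q (S j)
           * ((2 * INR (S j) + 2 * half_odd a) * (2 * INR (S j) + 2 * half_odd a + 1))
           / (4 * half_odd a * (2 * INR (S j) + half_odd a + 1))
         - sin_pow_coeff (S a) q j * ((2 * INR j + 1) * (2 * INR j + 2))
           / (4 * half_odd a * (2 * INR j + half_odd a + 1))).
Proof.
  intros Hj. unfold sin_pow_coeff. rewrite half_odd_S.
  pose proof (half_odd_ge a) as Hl. pose proof (pos_INR j). pose proof (pos_INR q).
  rewrite (Gamma_S (half_odd a)) by lra.
  rewrite (inv_fact_sub_S q (S j)) by lia. rewrite <- (inv_fact_sub_SS q j).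
  pose proof (expansion_coeff_S_0_double a (S j)) as Ha.
  assert (Ha' : expansion_coeff (S a) 0 (2 * S j)
                = expansion_coeff a 0 (2 * S j) / (2 * INR (S j) + 2 * half_odd a + 1)).
  { rewrite <- Ha. unfold half_odd. rewrite S_INR. pose proof (pos_INR a). field. lra. }
  rewrite Ha'.
  assert (Hb : expansion_coeff (S a) 0 (2 * j)
               = expansion_coeff a 0 (2 * S j) / (2 * INR j + 1)).
  { rewrite expansion_coeff_0_double_S. field. lra. }
  rewrite Hb. rewrite !S_INR.
  replace (INR q + 1 + (INR j + 1) + half_odd a + 1)
    with (INR q + INR j + half_odd a + 1 + 1 + 1) by ring.
  replace (INR q + (INR j + 1) + (half_odd a + 1) + 1)
    with (INR q + INR j + half_odd a + 1 + 1 + 1) by ring.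
  replace (INR q + INR j + (half_odd a + 1) + 1)
    with (INR q + INR j + half_odd a + 1 + 1) by ring.
  rewrite (Gamma_S (INR q + INR j + half_odd a + 1 + 1)) by lra.
  assert (0 < Gamma (INR q + INR j + half_odd a + 1 + 1)) by (apply Gamma_pos; lra).
  set (G := Gamma (INR q + INR j + half_odd a + 1 + 1)) in *.
  simpl ((-1) ^ S j). field. repeat split; lra.
Qed.

Lemma sin_pow_coeff_S_0 (a q : nat) :
  (INR q + 1) * sin_pow_coeff a (S q) 0
  = 2 * (sin_pow_coeff (S a) q 0
           * ((2 * INR 0 + 2 * half_odd a) * (2 * INR 0 + 2 * half_odd a + 1))
           / (4 * half_odd a * (2 * INR 0 + half_odd a + 1))).
Proof.
  unfold sin_pow_coeff. rewrite half_odd_S.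
  pose proof (half_odd_ge a) as Hl. pose proof (pos_INR q).
  rewrite (Gamma_S (half_odd a)) by lra. rewrite (inv_fact_sub_S q 0) by lia.
  pose proof (expansion_coeff_S_0_double a 0) as Ha.
  assert (Ha' : expansion_coeff (S a) 0 (2 * 0)
                = expansion_coeff a 0 (2 * 0) / (2 * half_odd a + 1)).
  { rewrite <- Ha. unfold half_odd. simpl (INR 0). pose proof (pos_INR a). field. lra. }
  rewrite Ha'. rewrite !S_INR. simpl (INR 0).
  replace (INR q + 1 + 0 + half_odd a + 1) with (INR q + half_odd a + 1 + 1) by ring.
  replace (INR q + 0 + (half_odd a + 1) + 1) with (INR q + half_odd a + 1 + 1) by ring.
  assert (0 < Gamma (INR q + half_odd a + 1 + 1)) by (apply Gamma_pos; lra).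
  field. repeat split; lra.
Qed.

Lemma sum_f_R0_shift (f : nat -> R) (n : nat) : sum_f_R0 (right_shift f) (S n) = sum_f_R0 f n.
Proof.
  induction n as [| n IH]; [simpl; ring |].
  rewrite tech5, IH. reflexivity.
Qed.

(** The induction keeps [a] general because multiplying by 1 - x^2 lowers the parameter: power q at
    lam + 1 yields power q + 1 at lam. *)
Lemma one_minus_sqr_pow_expansion (a q : nat) (x : R) :
  sum_f_R0 (fun j => sin_pow_coeff a q j * Gegenbauer (2 * j) (half_odd a) x) q
  = (1 - x ^ 2) ^ q / (INR (fact q) * INR (fact (q + a)) * 2 ^ a).
Proof.
  revert a. induction q as [| q IH]; intros a.
  - simpl sum_f_R0. rewrite Gegenbauer_0. unfold sin_pow_coeff.
    rewrite inv_fact_sub_le, expansion_coeff_even by reflexivity.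
    change (2 * 0 + 0 - 1)%nat with 0%nat.
    replace (2 * 0 + 2 * a - 0)%nat with (2 * a)%nat by lia.
    rewrite dfact_nat_double, mult_INR, pow_INR. simpl.
    pose proof (half_odd_ge a).
    replace (0 + 0 + half_odd a + 1) with (half_odd a + 1) by ring.
    rewrite (Gamma_S (half_odd a)) by lra.
    assert (0 < Gamma (half_odd a)) by (apply Gamma_pos; lra).
    pose proof (INR_fact_lt_0 a). replace (1 + 1) with 2 by ring.
    field. repeat split; try lra; apply pow_nonzero; lra.
  - pose proof (half_odd_ge a) as Hl. pose proof (pos_INR q) as Hq.
    set (C := fun j => Gegenbauer (2 * j) (half_odd a) x).
    set (A := fun j => sin_pow_coeff (S a) q j
           * ((2 * INR j + 2 * half_odd a) * (2 * INR j + 2 * half_odd a + 1))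
           / (4 * half_odd a * (2 * INR j + half_odd a + 1)) * C j).
    set (B := fun j => sin_pow_coeff (S a) q j * ((2 * INR j + 1) * (2 * INR j + 2))
           / (4 * half_odd a * (2 * INR j + half_odd a + 1)) * C (S j)).
    assert (H1 : (1 - x ^ 2) * sum_f_R0 (fun j => sin_pow_coeff (S a) q j
                     * Gegenbauer (2 * j) (half_odd (S a)) x) q
                 = sum_f_R0 A q - sum_f_R0 B q).
    { rewrite scal_sum, <- minus_sum. apply sum_eq. intros j _.
      pose proof (pos_INR j).
      pose proof (Gegenbauer_one_minus_sqr (2 * j) (half_odd a) x ltac:(lra)) as HG.
      rewrite <- half_odd_S in HG.
      replace (INR (2 * j)) with (2 * INR j) in HG by (rewrite mult_INR; simpl; ring).
      replace (S (S (2 * j))) with (2 * S j)%nat in HG by lia.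
      fold (C j) in HG. fold (C (S j)) in HG. unfold A, B.
      transitivity (sin_pow_coeff (S a) q j * (4 * half_odd a * (2 * INR j + half_odd a + 1)
         * ((1 - x ^ 2) * Gegenbauer (2 * j) (half_odd (S a)) x))
         / (4 * half_odd a * (2 * INR j + half_odd a + 1))).
      - field. lra.
      - rewrite HG. field. lra. }
    (* The added term has j = q + 1 > q and vanishes; both sums can now run over the same
       degrees. *)
    assert (HA : sum_f_R0 A q = sum_f_R0 A (S q)).
    { rewrite tech5. unfold A at 3, sin_pow_coeff. rewrite inv_fact_sub_gt by lia.
      unfold Rdiv. ring. }
    rewrite HA, <- (sum_f_R0_shift B), <- minus_sum in H1.
    apply (Rmult_eq_reg_l ((INR q + 1) / 2)); [| apply Rgt_not_eq, Rdiv_lt_0_compat; lra].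
    transitivity (sum_f_R0 (fun j => A j - right_shift B j) (S q)).
    + rewrite scal_sum. apply sum_eq. intros [| j] Hj.
      * pose proof (sin_pow_coeff_S_0 a q) as Hs. simpl right_shift. unfold A.
        transitivity ((INR q + 1) * sin_pow_coeff a (S q) 0 * (C 0%nat / 2)).
        -- unfold C. field.
        -- rewrite Hs. field. simpl. lra.
      * pose proof (sin_pow_coeff_S_pred a q j ltac:(lia)) as Hs. simpl right_shift. unfold A, B.
        transitivity ((INR q + 1) * sin_pow_coeff a (S q) (S j) * (C (S j) / 2)).
        -- unfold C. field.
        -- rewrite Hs. pose proof (pos_INR j). field. rewrite S_INR. repeat split; lra.
    + rewrite <- H1, IH. replace (q + S a)%nat with (S q + a)%nat by lia.
      rewrite (fact_simpl q), mult_INR, S_INR. simpl (2 ^ S a). rewrite <- (tech_pow_Rmult (1 - x ^ 2) q).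
      pose proof (INR_fact_lt_0 q). pose proof (INR_fact_lt_0 (S q + a)).
      field. repeat split; try lra. apply pow_nonzero. lra.
Qed.

(** * Rearrangement of double series *)

Lemma sum_antidiagonal (A : nat -> nat -> R) (n : nat) :
  sum_f_R0 (fun q => sum_f_R0 (fun j => A j (q - j)%nat) q) n
  = sum_f_R0 (fun j => sum_f_R0 (A j) (n - j)) n.
Proof.
  induction n as [| n IH]; [reflexivity |].
  rewrite tech5, IH, (tech5 (fun j => A j (S n - j)%nat)),
    (tech5 (fun j => sum_f_R0 (A j) (S n - j))).
  rewrite Nat.sub_diag. simpl (sum_f_R0 (A (S n)) 0).
  rewrite <- Rplus_assoc, <- plus_sum. f_equal. apply sum_eq. intros j Hj.
  now replace (S n - j)%nat with (S (n - j)) by lia.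
Qed.

Lemma is_series_half (c : R) : is_series (fun n => c * (/ 2) ^ n) (2 * c).
Proof.
  replace (2 * c) with (c * / (1 - / 2)) by field.
  apply is_series_scal_R, is_series_geom. rewrite Rabs_pos_eq; lra.
Qed.

Lemma Series_tail_half (a : nat -> R) (c : R) (n : nat) :
  (forall k, Rabs (a k) <= c * (/ 2) ^ k) ->
  Rabs (Series a - sum_f_R0 a n) <= c * (/ 2) ^ n.
Proof.
  intros H.
  assert (Hex : ex_series a).
  { apply (ex_series_le_R _ _ H). eexists. apply is_series_half. }
  rewrite (Series_incr_n a (S n)) by (auto; lia). simpl Init.Nat.pred.
  replace (sum_f_R0 a n + Series (fun k => a (S n + k)%nat) - sum_f_R0 a n)
    with (Series (fun k => a (S n + k)%nat)) by ring.
  assert (Hb : forall k, Rabs (a (S n + k)%nat) <= (c * (/ 2) ^ S n) * (/ 2) ^ k).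
  { intros k. rewrite Rmult_assoc, <- pow_add. apply H. }
  pose proof (is_series_half (c * (/ 2) ^ S n)) as Hs.
  eapply Rle_trans; [apply Series_Rabs |].
  - apply (ex_series_le_R _ (fun k => (c * (/ 2) ^ S n) * (/ 2) ^ k)).
    + intros k. rewrite Rabs_Rabsolu. apply Hb.
    + eexists. exact Hs.
  - apply Rle_trans with (2 * (c * (/ 2) ^ S n)); [| simpl; lra].
    rewrite <- (is_series_unique _ _ Hs). apply Series_le.
    + intros k. split; [apply Rabs_pos | apply Hb].
    + eexists. exact Hs.
Qed.

(** Since n + 1 <= 3 (3/2)^n, the sequence is squeezed by a geometric one of ratio 3/4. *)
Lemma is_lim_seq_linear_half (c : R) : is_lim_seq (fun n => c * ((INR n + 1) * (/ 2) ^ n)) 0.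
Proof.
  replace (Finite 0) with (Rbar_mult c 0) by (simpl; f_equal; ring).
  apply is_lim_seq_scal_l.
  apply (is_lim_seq_le_le (fun _ => 0) _ (fun n => 3 * (3 / 4) ^ n)).
  - intros n. pose proof (pos_INR n). assert (0 < (/ 2) ^ n) by (apply pow_lt; lra).
    split; [nra |].
    assert (H1 : INR n + 1 <= 3 * (3 / 2) ^ n).
    { induction n as [| n IH]; [simpl; lra |].
      assert (H3 : 1 <= (3 / 2) ^ n) by (apply pow_R1_Rle; lra).
      pose proof (pos_INR n). specialize (IH ltac:(assumption) ltac:(apply pow_lt; lra)).
      rewrite S_INR. simpl. lra. }
    replace (3 / 4) with (3 / 2 * / 2) by field. rewrite Rpow_mult_distr. nra.
  - apply is_lim_seq_const.
  - replace (Finite 0) with (Rbar_mult 3 0) by (simpl; f_equal; ring).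
    apply is_lim_seq_scal_l, is_lim_seq_geom. rewrite Rabs_pos_eq; lra.
Qed.

(** The antidiagonals up to n fill the triangle of entries with index sum at most n. Completing its
    row j costs a tail of at most c (1/2)^j (1/2)^(n-j) = c (1/2)^n, the same for every row, so the
    total error c (n + 1) (1/2)^n tends to 0. *)
Lemma is_series_antidiagonal (A : nat -> nat -> R) (c l : R) :
  (forall j n, Rabs (A j n) <= c * (/ 2) ^ j * (/ 2) ^ n) ->
  is_series (fun q => sum_f_R0 (fun j => A j (q - j)%nat) q) l ->
  is_series (fun j => Series (A j)) l.
Proof.
  intros HA Hl.
  assert (Hd : is_lim_seq (fun n => sum_f_R0 (fun j => Series (A j)) n
                 - sum_f_R0 (fun q => sum_f_R0 (fun j => A j (q - j)%nat) q) n) 0).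
  { apply is_lim_seq_abs_0.
    apply (is_lim_seq_le_le (fun _ => 0) _ (fun n => c * ((INR n + 1) * (/ 2) ^ n))).
    - intros n. split; [apply Rabs_pos |].
      rewrite sum_antidiagonal, <- minus_sum.
      eapply Rle_trans; [apply Rsum_abs |].
      apply Rle_trans with (sum_f_R0 (fun _ => c * (/ 2) ^ n) n).
      + apply sum_Rle. intros j Hj.
        eapply Rle_trans; [apply (Series_tail_half _ (c * (/ 2) ^ j)); apply HA |].
        rewrite Rmult_assoc, <- pow_add. replace (j + (n - j))%nat with n by lia. lra.
      + rewrite sum_cte, S_INR. lra.
    - apply is_lim_seq_const.
    - apply is_lim_seq_linear_half. }
  assert (Hl' : is_lim_seq (fun n => sum_f_R0 (fun q => sum_f_R0 (fun j => A j (q - j)%nat) q) n) l).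
  { apply (is_lim_seq_ext (sum_n (fun q => sum_f_R0 (fun j => A j (q - j)%nat) q)));
      [| exact Hl].
    intros n. apply sum_n_Reals. }
  pose proof (is_lim_seq_plus' _ _ _ _ Hd Hl') as H.
  rewrite Rplus_0_l in H.
  apply (is_lim_seq_ext _ (sum_n (fun j => Series (A j)))) in H; [exact H |].
  intros n. simpl. rewrite sum_n_Reals. ring.
Qed.

(** A single term of the exponential series at 2 y is at most its sum; dividing by 2^n turns
    factorial decay into the geometric decay used for rearrangement. *)
Lemma pow_div_fact_bound (y : R) (n : nat) : 0 <= y ->
  y ^ n / INR (fact n) <= exp (2 * y) * (/ 2) ^ n.
Proof.
  intros Hy.
  assert (H : (2 * y) ^ n / INR (fact n) <= exp (2 * y)).
  { rewrite <- (is_series_unique _ _ (is_series_exp (2 * y))).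
    assert (Hpos : forall k, 0 <= (2 * y) ^ k / INR (fact k)).
    { intros k. apply Rmult_le_pos; [apply pow_le; lra |].
      left. apply Rinv_0_lt_compat, INR_fact_lt_0. }
    rewrite (Series_incr_n _ (S n)); [| lia | eexists; apply is_series_exp].
    simpl Init.Nat.pred.
    assert (0 <= Series (fun k => (2 * y) ^ (S n + k) / INR (fact (S n + k)))).
    { rewrite <- (Rmult_0_l (Series (fun k => (2 * y) ^ (S n + k) / INR (fact (S n + k))))).
      rewrite <- Series_scal_l. apply Series_le.
      - intros k. specialize (Hpos (S n + k)%nat). lra.
      - apply (ex_series_incr_n (fun k => (2 * y) ^ k / INR (fact k)) (S n)).
        eexists. apply is_series_exp. }
    assert ((2 * y) ^ n / INR (fact n) <= sum_f_R0 (fun k => (2 * y) ^ k / INR (fact k)) n).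
    { destruct n as [| n]; [simpl; lra |]. rewrite tech5.
      pose proof (cond_pos_sum _ n Hpos). lra. }
    lra. }
  rewrite Rpow_mult_distr in H.
  assert (0 < 2 ^ n) by (apply pow_lt; lra). rewrite pow_inv.
  apply (Rmult_le_reg_l (2 ^ n)); [assumption |].
  replace (2 ^ n * (exp (2 * y) * / 2 ^ n)) with (exp (2 * y)) by (field; lra).
  unfold Rdiv in *. lra.
Qed.

(** With 2^(2j) / (2j)! <= 4^j / j!, the growth B^j of [s] is absorbed into (4 B)^j / j!; then both
    indices decay geometrically. *)
Lemma bessel_term_even_bound (a : nat) (z : R) (s : nat -> R) : exp_bounded s ->
  exists c, forall j n, Rabs (s j * bessel_term (INR (2 * j) + half_odd a) z n)
    <= c * (/ 2) ^ j * (/ 2) ^ n.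
Proof.
  intros (K & B & HK & HB & Hs). pose proof (half_odd_ge a).
  set (y := 2 * (z / 2) ^ 2). assert (Hy : 0 <= y) by (unfold y; nra).
  assert (HG : 0 < / Gamma (half_odd a + 1)) by (apply Rinv_0_lt_compat, Gamma_pos; lra).
  exists (K * / Gamma (half_odd a + 1) * exp (2 * (4 * B)) * exp (2 * y)).
  intros j n. rewrite Rabs_mult.
  pose proof (bessel_term_bound (half_odd a) z (2 * j) n ltac:(lra)) as Hb. fold y in Hb.
  pose proof (pow_div_fact_bound (4 * B) j ltac:(lra)) as H1.
  pose proof (pow_div_fact_bound y n Hy) as H2.
  pose proof (INR_fact_lt_0 j). pose proof (INR_fact_lt_0 n).
  assert (0 <= B ^ j) by (apply pow_le; lra).
  assert (Hf : 2 ^ (2 * j) / INR (fact (2 * j)) <= 4 ^ j / INR (fact j)).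
  { rewrite pow_mult. replace (2 ^ 2) with 4 by ring.
    apply Rmult_le_compat_l; [apply pow_le; lra |].
    apply Rinv_le_contravar; [assumption |]. apply le_INR, fact_le. lia. }
  apply Rle_trans with (K * B ^ j * (/ Gamma (half_odd a + 1) * (4 ^ j / INR (fact j))
                        * (y ^ n / INR (fact n)))).
  - apply Rmult_le_compat; try apply Rabs_pos; [apply Hs |].
    eapply Rle_trans; [exact Hb |]. apply Rmult_le_compat_r.
    + apply Rmult_le_pos; [now apply pow_le | left; now apply Rinv_0_lt_compat].
    + apply Rmult_le_compat_l; [lra | exact Hf].
  - rewrite Rpow_mult_distr in H1.
    replace (K * B ^ j * (/ Gamma (half_odd a + 1) * (4 ^ j / INR (fact j)) * (y ^ n / INR (fact n))))
      with (K * / Gamma (half_odd a + 1) * ((4 ^ j * B ^ j / INR (fact j)) * (y ^ n / INR (fact n))))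
      by (unfold Rdiv; ring).
    replace (K * / Gamma (half_odd a + 1) * exp (2 * (4 * B)) * exp (2 * y) * (/ 2) ^ j * (/ 2) ^ n)
      with (K * / Gamma (half_odd a + 1)
            * ((exp (2 * (4 * B)) * (/ 2) ^ j) * (exp (2 * y) * (/ 2) ^ n))) by ring.
    apply Rmult_le_compat_l; [apply Rmult_le_pos; lra |].
    apply Rmult_le_compat; try assumption.
    + apply Rmult_le_pos; [| left; now apply Rinv_0_lt_compat].
      apply Rmult_le_pos; [apply pow_le; lra | assumption].
    + apply Rmult_le_pos; [now apply pow_le | left; now apply Rinv_0_lt_compat].
Qed.

Lemma is_series_Jtilde (a : nat) (t : R) :
  is_series (fun q => bessel_term (INR a) t q / 2 ^ a) (Jtilde (INR a) t).
Proof.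
  unfold Jtilde. rewrite Rpower_pow by lra.
  apply (is_series_ext_R (fun q => / 2 ^ a * bessel_term (INR a) t q)).
  - intros q. unfold Rdiv. apply Rmult_comm.
  - match goal with |- is_series _ (?v / ?p) => rewrite (Rmult_comm v (/ p) : v / p = _) end.
    apply is_series_scal_R.
    apply Series_correct, ex_series_bessel. pose proof (pos_INR a). lra.
Qed.

Lemma half_tv_pow (z w : R) (q : nat) : -1 <= w <= 1 ->
  (tv z w / 2) ^ (2 * q) = ((z / 2) ^ 2) ^ q * (1 - w ^ 2) ^ q.
Proof.
  intros Hw. rewrite pow_mult, <- Rpow_mult_distr. f_equal. unfold tv.
  transitivity ((z / 2) ^ 2 * (sqrt (1 - w ^ 2) * sqrt (1 - w ^ 2))); [field |].
  rewrite sqrt_sqrt by nra. reflexivity.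
Qed.

(** Expanding each Bessel factor gives a double series in j and n whose antidiagonal j + n = q
    collects (z/2)^(2q). By the expansion of (1 - w^2)^q it equals the q-th term of [Jtilde]. *)
Lemma is_series_Jtilde_even (a : nat) (z w : R) : -1 <= w <= 1 ->
  is_series (fun j => Gamma (half_odd a) * (expansion_coeff a 0 (2 * j)
      * ((INR (2 * j) + half_odd a) * bessel_gegenbauer (half_odd a) z w (2 * j))))
    (Jtilde (INR a) (tv z w)).
Proof.
  intros Hw. pose proof (half_odd_ge a) as Hl.
  set (s := fun j => Gamma (half_odd a) * (expansion_coeff a 0 (2 * j)
              * ((INR (2 * j) + half_odd a) * ((z / 2) ^ (2 * j)
                 * Gegenbauer (2 * j) (half_odd a) w)))).
  assert (Hs : exp_bounded s).
  { apply exp_bounded_mult; [apply exp_bounded_const |].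
    apply (exp_bounded_even (fun k => expansion_coeff a 0 k
              * ((INR k + half_odd a) * ((z / 2) ^ k * Gegenbauer k (half_odd a) w)))).
    apply exp_bounded_mult; [apply exp_bounded_expansion_coeff; lia |].
    apply exp_bounded_mult; [apply exp_bounded_linear |].
    apply exp_bounded_mult; [apply exp_bounded_pow | apply exp_bounded_Gegenbauer; lra]. }
  destruct (bessel_term_even_bound a z s Hs) as [c Hc].
  apply (is_series_ext_R (fun j => Series (fun n => s j * bessel_term (INR (2 * j) + half_odd a) z n))).
  { intros j. rewrite Series_scal_l. unfold s, bessel_gegenbauer, bessel_series. ring. }
  apply (is_series_antidiagonal _ _ _ Hc).
  apply (is_series_ext_R (fun q => bessel_term (INR a) (tv z w) q / 2 ^ a));
    [| apply is_series_Jtilde].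
  intros q. unfold bessel_term at 1. rewrite half_tv_pow by assumption.
  replace (INR q + INR a + 1) with (INR (q + a) + 1) by (rewrite plus_INR; ring).
  rewrite Gamma_nat.
  transitivity ((-1) ^ q * ((z / 2) ^ 2) ^ q *
    ((1 - w ^ 2) ^ q / (INR (fact q) * INR (fact (q + a)) * 2 ^ a))).
  - pose proof (INR_fact_lt_0 q). pose proof (INR_fact_lt_0 (q + a)).
    field. repeat split; try lra. apply pow_nonzero. lra.
  - rewrite <- one_minus_sqr_pow_expansion, scal_sum. apply sum_eq. intros j Hj.
    unfold s, bessel_term, sin_pow_coeff. rewrite inv_fact_sub_le by assumption.
    replace (INR (q - j) + (INR (2 * j) + half_odd a) + 1)
      with (INR q + INR j + half_odd a + 1)
      by (rewrite minus_INR, mult_INR by assumption; simpl; ring).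
    replace (INR (2 * j)) with (2 * INR j) by (rewrite mult_INR; simpl; ring).
    replace ((-1) ^ q) with ((-1) ^ (q - j) * (-1) ^ j)
      by (rewrite <- pow_add; f_equal; lia).
    rewrite (pow_mult (z / 2) 2 j), (pow_mult (z / 2) 2 (q - j)).
    replace (((z / 2) ^ 2) ^ q) with (((z / 2) ^ 2) ^ (q - j) * ((z / 2) ^ 2) ^ j)
      by (rewrite <- pow_add; f_equal; lia).
    assert (Hsq : (-1) ^ j * (-1) ^ j = 1)
      by (rewrite <- Rpow_mult_distr; replace (-1 * -1) with 1 by ring; apply pow1).
    pose proof (INR_fact_lt_0 (q - j)). pose proof (pos_INR q). pose proof (pos_INR j).
    assert (0 < Gamma (INR q + INR j + half_odd a + 1)) by (apply Gamma_pos; lra).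
    (* The left side carries the sign (-1)^(q-j) times the square of (-1)^j; the square, equal to 1,
       is inserted on the right to match. *)
    match goal with |- _ = ?r => transitivity (r * ((-1) ^ j * (-1) ^ j)) end.
    + field. lra.
    + rewrite Hsq. ring.
Qed.

(** * Series supported on indices of one parity *)

Lemma is_series_even (f : nat -> R) (l : R) :
  (forall j, f (S (2 * j)) = 0) -> is_series f l -> is_series (fun j => f (2 * j)%nat) l.
Proof.
  intros H0 Hf.
  assert (E : forall n, sum_n (fun j => f (2 * j)%nat) n = sum_n f (2 * n)).
  { induction n as [| n IH]; [now rewrite !sum_O |].
    rewrite sum_Sn, IH. replace (2 * S n)%nat with (S (S (2 * n))) by lia.
    rewrite !sum_Sn, H0. unfold plus; simpl. now rewrite Rplus_0_r. }
  apply (filterlim_ext (fun n => sum_n f (2 * n))); [intros n; symmetry; apply E |].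
  apply (filterlim_comp _ _ _ (fun n => (2 * n)%nat) (sum_n f) _ eventually); [| exact Hf].
  intros P [N HN]. exists N. intros n Hn. apply HN. lia.
Qed.

Lemma is_series_odd (f : nat -> R) (l : R) :
  (forall j, f (2 * j)%nat = 0) -> is_series f l -> is_series (fun j => f (2 * j + 1)%nat) l.
Proof.
  intros H0 Hf.
  apply (is_series_ext_R (fun j => f (S (2 * j)))); [intros j; f_equal; lia |].
  assert (H00 : f 0%nat = 0) by (apply (H0 0%nat)).
  apply (is_series_even (fun k => f (S k))).
  - intros j. replace (S (S (2 * j))) with (2 * S j)%nat by lia. apply H0.
  - apply (is_series_incr_1 (V := R_NormedModule)). rewrite H00.
    unfold plus; simpl. now rewrite Rplus_0_r.
Qed.

Lemma is_series_of_even (f : nat -> R) (l : R) :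
  (forall j, f (S (2 * j)) = 0) -> is_series (fun j => f (2 * j)%nat) l -> is_series f l.
Proof.
  intros H0 Hf.
  assert (E : forall n, sum_n f (2 * n) = sum_n (fun j => f (2 * j)%nat) n
                     /\ sum_n f (S (2 * n)) = sum_n (fun j => f (2 * j)%nat) n).
  { induction n as [| n [IH1 IH2]].
    - change (2 * 0)%nat with 0%nat. rewrite sum_Sn, !sum_O.
      pose proof (H0 0%nat) as H1. change (S (2 * 0)) with 1%nat in H1. rewrite H1.
      unfold plus; simpl. now rewrite Rplus_0_r.
    - assert (E1 : sum_n f (2 * S n) = sum_n (fun j => f (2 * j)%nat) (S n)).
      { replace (2 * S n)%nat with (S (S (2 * n))) by lia.
        rewrite (sum_Sn f (S (2 * n))), IH2, (sum_Sn (fun j => f (2 * j)%nat)).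
        now replace (2 * S n)%nat with (S (S (2 * n))) by lia. }
      split; [exact E1 |]. rewrite sum_Sn, E1, H0. unfold plus; simpl. apply Rplus_0_r. }
  apply (filterlim_ext (fun n => sum_n (fun j => f (2 * j)%nat) (Nat.div2 n))).
  - intros n. destruct (Nat.even n) eqn:En.
    + apply Nat.even_spec in En as [p ->]. rewrite Nat.div2_double. symmetry. apply E.
    + assert (Ho : Nat.odd n = true) by (unfold Nat.odd; now rewrite En).
      apply Nat.odd_spec in Ho as [p ->]. rewrite Nat.add_1_r, Nat.div2_succ_double.
      symmetry. apply E.
  - apply (filterlim_comp _ _ _ Nat.div2 (sum_n (fun j => f (2 * j)%nat)) _ eventually);
      [| exact Hf].
    intros P [N HN]. exists (2 * N)%nat. intros n Hn. apply HN.
    rewrite Nat.div2_div. apply Nat.div_le_lower_bound; lia.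
Qed.

(** * The functions of the paper *)

(** Up to sign, the coefficients of the probabilists' Hermite polynomial of degree i. The value 0
    for 2 l > i lets sums for different i share one range. *)
Definition hermite_coeff (i l : nat) : R :=
  if (2 * l <=? i)%nat
  then INR (fact i) / (2 ^ l * INR (fact l) * INR (fact (i - 2 * l))) else 0.

Lemma hermite_coeff_le (i l : nat) : (2 * l <= i)%nat ->
  hermite_coeff i l = INR (fact i) / (2 ^ l * INR (fact l) * INR (fact (i - 2 * l))).
Proof. intros H. unfold hermite_coeff. now apply Nat.leb_le in H as ->. Qed.

Lemma hermite_coeff_gt (i l : nat) : (i < 2 * l)%nat -> hermite_coeff i l = 0.
Proof. intros H. unfold hermite_coeff. now apply Nat.leb_gt in H as ->. Qed.

Lemma sum_f_R0_extend (f : nat -> R) (p n : nat) : (p <= n)%nat ->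
  (forall l, (p < l)%nat -> f l = 0) -> sum_f_R0 f p = sum_f_R0 f n.
Proof.
  intros Hpn Hf. induction n as [| n IH]; [now replace p with 0%nat by lia |].
  destruct (Nat.eq_dec p (S n)) as [-> | Hne]; [reflexivity |].
  rewrite tech5, (Hf (S n)), IH by lia. ring.
Qed.

Lemma INR_double_S (a : nat) : INR (2 * a + 1) = 2 * INR a + 1.
Proof. rewrite plus_INR, mult_INR. simpl. ring. Qed.

Lemma gfun_hermite (a i n : nat) (s t : R) : (i <= 2 * n + 1)%nat ->
  gfun (2 * a + 1) i s t
  = sum_f_R0 (fun l => hermite_coeff i l * s ^ (i - 2 * l) * Jtilde (INR a - INR l) t) n.
Proof.
  intros Hn.
  assert (Hdiv : i = (2 * (i / 2) + i mod 2)%nat) by (apply Nat.div_mod_eq).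
  assert (Hmod : (i mod 2 < 2)%nat) by (apply Nat.mod_upper_bound; lia).
  rewrite <- (sum_f_R0_extend _ (i / 2) n).
  - unfold gfun. apply sum_eq. intros l Hl.
    assert (Hl2 : (2 * l <= i)%nat) by lia.
    rewrite hermite_coeff_le, Gamma_nat by assumption.
    replace (INR i + 1 - 2 * INR l) with (INR (i - 2 * l) + 1)
      by (rewrite minus_INR, mult_INR by assumption; simpl; ring).
    rewrite Gamma_nat, INR_double_S.
    replace ((2 * INR a + 1 - 2 * INR l - 1) / 2) with (INR a - INR l) by field.
    pose proof (INR_fact_lt_0 l). pose proof (INR_fact_lt_0 (i - 2 * l)).
    field. repeat split; try lra. apply pow_nonzero. lra.
  - lia.
  - intros l Hl. rewrite hermite_coeff_gt by lia. ring.
Qed.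

(** Coefficient form of H_(i+2) = s H_(i+1) + (i + 1) H_i. For i = 2 l the exponent in the middle
    term is truncated, which is harmless because its coefficient is 0. *)
Lemma hermite_coeff_rec (i l : nat) (s : R) :
  hermite_coeff (S (S i)) (S l) * s ^ (S (S i) - 2 * S l)
  = s * (hermite_coeff (S i) (S l) * s ^ (S i - 2 * S l))
    + INR (S i) * (hermite_coeff i l * s ^ (i - 2 * l)).
Proof.
  replace (S (S i) - 2 * S l)%nat with (i - 2 * l)%nat by lia.
  pose proof (INR_fact_lt_0 l). pose proof (pos_INR l).
  assert (H2 : 2 ^ l <> 0) by (apply pow_nonzero; lra).
  destruct (le_lt_dec (2 * l) i) as [Hle | Hgt].
  - rewrite (hermite_coeff_le (S (S i))), (hermite_coeff_le i) by lia.
    replace (S (S i) - 2 * S l)%nat with (i - 2 * l)%nat by lia.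
    destruct (Nat.eq_dec i (2 * l)) as [He | Hne].
    + rewrite (hermite_coeff_gt (S i)) by lia.
      replace (i - 2 * l)%nat with 0%nat by lia.
      rewrite (fact_simpl (S i)), (fact_simpl i), (fact_simpl l), !mult_INR.
      replace (INR (S (S i))) with (2 * INR (S l))
        by (rewrite He, !S_INR, mult_INR; simpl; ring).
      rewrite (S_INR l). simpl (INR (fact 0)). simpl (2 ^ S l). field. lra.
    + rewrite (hermite_coeff_le (S i)) by lia.
      replace (S i - 2 * S l)%nat with (i - 2 * l - 1)%nat by lia.
      assert (E : (i - 2 * l = S (i - 2 * l - 1))%nat) by lia.
      set (p := (i - 2 * l - 1)%nat) in *. rewrite E.
      rewrite (fact_simpl (S i)), (fact_simpl i), (fact_simpl l), (fact_simpl p), !mult_INR.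
      replace (INR (S (S i))) with (2 * INR (S l) + INR (S p))
        by (replace i with (2 * l + S p)%nat by lia;
            rewrite !S_INR, plus_INR, mult_INR, !S_INR; simpl; ring).
      rewrite (S_INR l), (S_INR p). simpl (2 ^ S l). simpl (s ^ S p).
      pose proof (INR_fact_lt_0 p). pose proof (pos_INR p). field. lra.
  - rewrite !hermite_coeff_gt by lia. ring.
Qed.

Lemma hermite_coeff_0 (i : nat) : hermite_coeff i 0 = 1.
Proof.
  rewrite hermite_coeff_le by lia. rewrite Nat.sub_0_r. simpl.
  pose proof (INR_fact_lt_0 i). field. lra.
Qed.

(** Raising l by one lowers the Bessel order a - l by one, just as passing from m to m - 2 does. The
    second term of the Hermite recurrence therefore lands in dimension m - 2. *)
Lemma gfun_rec (a i : nat) (s t : R) :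
  gfun (2 * S a + 1) (S (S i)) s t
  = s * gfun (2 * S a + 1) (S i) s t + INR (S i) * gfun (2 * a + 1) i s t.
Proof.
  rewrite (gfun_hermite (S a) (S (S i)) (S i)), (gfun_hermite (S a) (S i) (S i)),
    (gfun_hermite a i i) by lia.
  rewrite !(decomp_sum _ (S i)) by lia. simpl Init.Nat.pred.
  rewrite Rmult_plus_distr_l, !hermite_coeff_0, !scal_sum, Rplus_assoc.
  f_equal; [simpl; ring |].
  rewrite <- plus_sum. apply sum_eq. intros l _.
  rewrite hermite_coeff_rec.
  replace (INR (S a) - INR (S l)) with (INR a - INR l) by (rewrite !S_INR; ring).
  ring.
Qed.

Lemma gfun_0 (a : nat) (s t : R) : gfun (2 * a + 1) 0 s t = Jtilde (INR a) t.
Proof.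
  rewrite (gfun_hermite a 0 0) by lia. simpl. rewrite hermite_coeff_0, Rminus_0_r. ring.
Qed.

Lemma gfun_1 (a : nat) (s t : R) : gfun (2 * a + 1) 1 s t = s * Jtilde (INR a) t.
Proof.
  rewrite (gfun_hermite a 1 0) by lia. simpl. rewrite hermite_coeff_0, Rminus_0_r. ring.
Qed.

(** The recurrence reaches back two steps in i and changes the dimension, so the induction carries i
    and i + 1 together, for all [a]. *)
Lemma is_series_gfun (a i : nat) (z w : R) : -1 <= w <= 1 -> (i <= 2 * a + 1)%nat ->
  is_series (fun k => Gamma (half_odd a) * expansion_coeff a i k
      * ((INR k + half_odd a) * bessel_gegenbauer (half_odd a) z w k))
    (gfun (2 * a + 1) i (sv z w) (tv z w)).
Proof.
  intros Hw.
  assert (Hbase : forall b, is_series (fun k => Gamma (half_odd b) * expansion_coeff b 0 k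
      * ((INR k + half_odd b) * bessel_gegenbauer (half_odd b) z w k))
      (Jtilde (INR b) (tv z w))).
  { intros b. apply is_series_of_even.
    - intros j. rewrite expansion_coeff_odd; [ring |].
      rewrite Nat.add_0_r, Nat.even_succ, Nat.odd_mul. reflexivity.
    - eapply is_series_ext_R; [| exact (is_series_Jtilde_even b z w Hw)].
      intros j. simpl. ring. }
  revert a. enough (H : forall a,
    ((i <= 2 * a + 1)%nat ->
      is_series (fun k => Gamma (half_odd a) * expansion_coeff a i k
        * ((INR k + half_odd a) * bessel_gegenbauer (half_odd a) z w k))
        (gfun (2 * a + 1) i (sv z w) (tv z w))) /\
    ((S i <= 2 * a + 1)%nat ->
      is_series (fun k => Gamma (half_odd a) * expansion_coeff a (S i) k
        * ((INR k + half_odd a) * bessel_gegenbauer (half_odd a) z w k))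
        (gfun (2 * a + 1) (S i) (sv z w) (tv z w)))) by (intros a; apply H).
  induction i as [| i IH]; intros a; pose proof (half_odd_ge a) as Hl;
    split; try (now apply IH); intros Hi.
  - rewrite gfun_0. apply Hbase.
  (* For i = 1 there is no lower-dimensional term; the general step applies with d = 0. *)
  - rewrite gfun_1. unfold sv. rewrite <- (Rplus_0_r (z * w * _)).
    apply (is_series_bessel_gegenbauer_step _ _ _
             (fun k => Gamma (half_odd a) * expansion_coeff a 0 k) (fun _ => 0)); try assumption.
    + apply exp_bounded_mult; [apply exp_bounded_const |].
      apply exp_bounded_expansion_coeff. lia.
    + apply exp_bounded_const.
    + rewrite expansion_coeff_odd by reflexivity. ring.
    + intros k. rewrite expansion_coeff_1_S. ring.
    + intros k. rewrite expansion_coeff_1. unfold half_odd. field.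
    + apply Hbase.
    + rewrite <- (Rmult_0_l (2 * 0)). eapply is_series_ext_R; [| apply is_series_scal_R, is_series_half].
      intros k. simpl. ring.
  - destruct a as [| a]; [lia |].
    pose proof (half_odd_ge a) as Hla.
    rewrite gfun_rec.
    apply (is_series_bessel_gegenbauer_step _ _ _
             (fun k => Gamma (half_odd (S a)) * expansion_coeff (S a) (S i) k)
             (fun k => Gamma (half_odd (S a)) * INR (S i) * expansion_coeff a i k));
      try assumption.
    + apply exp_bounded_mult; [apply exp_bounded_const |].
      apply exp_bounded_expansion_coeff. lia.
    + apply exp_bounded_mult; [apply exp_bounded_const |].
      apply exp_bounded_expansion_coeff. lia.
    + rewrite expansion_coeff_0 by lia. ring.
    + intros k. rewrite expansion_coeff_raise by lia. ring.
    + intros k. rewrite expansion_coeff_lower by lia.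
      unfold half_odd. rewrite !(S_INR a). field.
    + apply IH. lia.
    (* The series for m - 2 is re-expanded at parameter lam + 1; the factor lam that this produces
       turns Gamma (lam) into Gamma (lam + 1). *)
    + eapply is_series_ext_R; [| apply (is_series_scal_R (INR (S i))), (proj1 (IH a)); lia].
      intros k. unfold bessel_gegenbauer. rewrite half_odd_S.
      replace (half_odd a + 1 - 1) with (half_odd a) by ring.
      rewrite Gamma_S by lra.
      pose proof (Gegenbauer_shift_diff k (half_odd a) w ltac:(lra)) as HG.
      transitivity (INR (S i) * (Gamma (half_odd a) * expansion_coeff a i k
        * bessel_series (INR k + half_odd a) z * (z / 2) ^ k
        * ((INR k + half_odd a) * Gegenbauer k (half_odd a) w))); [ring |].
      rewrite HG. ring.
Qed.

(** The power z^(-lam) cancels the fractional part of the order and leaves the integer power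
    (z/2)^k; the factor 1/2 comes from the exponent lam - 1 of 2. *)
Lemma BesselJ_normalized (lam z : R) (k : nat) : 0 < z ->
  Rpower 2 (lam - 1) * Rpower z (- lam) * BesselJ (INR k + lam) z
  = / 2 * (bessel_series (INR k + lam) z * (z / 2) ^ k).
Proof.
  intros Hz. unfold BesselJ.
  change (Series _) with (bessel_series (INR k + lam) z).
  rewrite Rpower_plus, Rpower_pow, Rpower_minus_1, Rpower_Ropp by lra.
  unfold Rdiv at 3. rewrite <- (Rpower_mult_distr z (/ 2)) by lra.
  assert (E : Rpower (/ 2) lam = / Rpower 2 lam).
  { unfold Rpower. rewrite ln_Rinv, <- exp_Ropp by lra. f_equal. ring. }
  rewrite E. pose proof (Rpower_pos 2 lam). pose proof (Rpower_pos z lam). field. lra.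
Qed.

Lemma gfun_term (a i k : nat) (z w : R) : 0 < z ->
  Gamma (half_odd a) * expansion_coeff a i k
    * ((INR k + half_odd a) * bessel_gegenbauer (half_odd a) z w k)
  = Rpower 2 (half_odd a - 1) * Gamma (half_odd a)
    * (2 * (INR k + half_odd a) * expansion_coeff a i k * Rpower z (- half_odd a)
       * BesselJ (INR k + half_odd a) z * Gegenbauer k (half_odd a) w).
Proof.
  intros Hz. unfold bessel_gegenbauer.
  pose proof (BesselJ_normalized (half_odd a) z k Hz) as H.
  transitivity (2 * (/ 2 * (bessel_series (INR k + half_odd a) z * (z / 2) ^ k))
    * (Gamma (half_odd a) * expansion_coeff a i k * (INR k + half_odd a)
       * Gegenbauer k (half_odd a) w)); [field |].
  rewrite <- H. ring.
Qed.

Lemma is_series_gfun_even (a i : nat) (z w : R) :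
  0 < z -> -1 <= w <= 1 -> (i <= 2 * a + 1)%nat -> Nat.even i = true ->
  is_series (fun j => Rpower 2 (half_odd a - 1) * Gamma (half_odd a)
    * (2 * (2 * INR j + half_odd a)
       * (INR (dfact_nat (2 * j + i - 1)) / INR (dfact_nat (2 * j + 2 * a - i)))
       * Rpower z (- half_odd a) * BesselJ (2 * INR j + half_odd a) z
       * Gegenbauer (2 * j) (half_odd a) w))
    (gfun (2 * a + 1) i (sv z w) (tv z w)).
Proof.
  intros Hz Hw Hi Ei.
  eapply is_series_ext_R; [| apply is_series_even; [| exact (is_series_gfun a i z w Hw Hi)]].
  - intros j. cbv beta. rewrite gfun_term by assumption.
    rewrite expansion_coeff_even by (rewrite Nat.even_add, Nat.even_mul, Ei; reflexivity).
    now replace (INR (2 * j)) with (2 * INR j) by (rewrite mult_INR; simpl; ring).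
  - intros j. cbv beta. rewrite expansion_coeff_odd; [ring |].
    rewrite Nat.even_add, Nat.even_succ, Nat.odd_mul, Ei. reflexivity.
Qed.

Lemma is_series_gfun_odd (a i : nat) (z w : R) :
  0 < z -> -1 <= w <= 1 -> (i <= 2 * a + 1)%nat -> Nat.even i = false ->
  is_series (fun j => Rpower 2 (half_odd a - 1) * Gamma (half_odd a)
    * (2 * (2 * INR j + 1 + half_odd a)
       * (INR (dfact_nat (2 * j + i)) / INR (dfact_nat (2 * j + 1 + 2 * a - i)))
       * Rpower z (- half_odd a) * BesselJ (2 * INR j + 1 + half_odd a) z
       * Gegenbauer (2 * j + 1) (half_odd a) w))
    (gfun (2 * a + 1) i (sv z w) (tv z w)).
Proof.
  intros Hz Hw Hi Ei.
  eapply is_series_ext_R; [| apply is_series_odd; [| exact (is_series_gfun a i z w Hw Hi)]].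
  - intros j. cbv beta. rewrite gfun_term by assumption.
    rewrite expansion_coeff_even
      by (rewrite Nat.even_add, Nat.add_1_r, Nat.even_succ, Nat.odd_mul, Ei; reflexivity).
    replace (2 * j + 1 + i - 1)%nat with (2 * j + i)%nat by lia.
    now rewrite INR_double_S.
  - intros j. cbv beta. rewrite expansion_coeff_odd; [ring |].
    rewrite Nat.even_add, Nat.even_mul, Ei. reflexivity.
Qed.

(** Gamma (i + 2) = (i + 1) Gamma (i + 1) releases the factor, and the order (m - 2 l - 3) / 2 is
    the one that [gfun] has in dimension m - 2. *)
Lemma ftilde_gfun (a i : nat) (s t : R) :
  ftilde (2 * S a + 1) (S i) s t = - INR (S i) * gfun (2 * a + 1) i s t.
Proof.
  unfold ftilde, gfun. replace (S i - 1)%nat with i by lia.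
  rewrite Ropp_mult_distr_l_reverse, scal_sum. f_equal. apply sum_eq. intros l _.
  rewrite !INR_double_S, Gamma_S, S_INR by (rewrite S_INR; pose proof (pos_INR i); lra).
  replace ((2 * INR (S a) + 1 - 2 * INR l - 3) / 2)
    with ((2 * INR a + 1 - 2 * INR l - 1) / 2) by (rewrite S_INR; field).
  unfold Rdiv. ring.
Qed.

Lemma fhat_gfun (a i : nat) (s t : R) :
  fhat (2 * S a + 1) i s t
  = (-1) ^ ((2 * S a + 1 + 1) / 2 + i) * gfun (2 * a + 1) i s t.
Proof.
  unfold fhat, gfun. f_equal. apply sum_eq. intros l _.
  rewrite !INR_double_S.
  now replace ((2 * INR (S a) + 1 - 2 * INR l - 3) / 2)
    with ((2 * INR a + 1 - 2 * INR l - 1) / 2) by (rewrite S_INR; field).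
Qed.

Lemma pow_m1_even (n : nat) : Nat.even n = true -> (-1) ^ n = 1.
Proof. intros H. apply Nat.even_spec in H as [p ->]. apply pow_1_even. Qed.

Lemma pow_m1_odd (n : nat) : Nat.even n = false -> (-1) ^ n = -1.
Proof.
  intros H. assert (Ho : Nat.odd n = true) by (unfold Nat.odd; now rewrite H).
  apply Nat.odd_spec in Ho as [p ->]. rewrite Nat.add_1_r. apply pow_1_odd.
Qed.

Lemma dfact_nat_eq (u : Z) (n : nat) : Z.to_nat u = n -> dfact u = INR (dfact_nat n).
Proof. now intros <-. Qed.

Theorem theorem5p3 (m i : nat) :
  (3 <= m)%nat -> Nat.odd m = true -> (i <= m - 2)%nat ->
  forall z w : R, 0 < z -> -1 <= w <= 1 ->
  let M := INR m in
  let I := Z.of_nat i in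
  let mz := Z.of_nat m in
  if Nat.even i then
    is_series
      (fun j : nat => - INR i * Rpower 2 (M / 2 - 2) * Gamma (M / 2 - 1) *
         ((4 * INR j + M) * (dfact (2 * Z.of_nat j + I - 1) / dfact (2 * Z.of_nat j + mz - I - 1))
          * Rpower z (- M / 2 + 1) * BesselJ (2 * INR j + M / 2) z
          * Gegenbauer (2 * j + 1) (M / 2 - 1) w))
      (ftilde m i (sv z w) (tv z w))
    /\
    is_series
      (fun j : nat => (-1) ^ ((m + 1) / 2) * Rpower 2 (M / 2 - 1) * Gamma (M / 2 - 1) *
         ((2 * INR j + M / 2 - 1) * (dfact (2 * Z.of_nat j + I - 1) / dfact (2 * Z.of_nat j - I + mz - 3))
          * Rpower z (1 - M / 2) * BesselJ (2 * INR j + M / 2 - 1) z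
          * Gegenbauer (2 * j) (M / 2 - 1) w))
      (fhat m i (sv z w) (tv z w))
    /\
    is_series
      (fun j : nat => Rpower 2 (M / 2 - 1) * Gamma (M / 2) *
         ((4 * INR j + M) * (dfact (2 * Z.of_nat j + I - 1) / dfact (2 * Z.of_nat j + mz - I - 1))
          * Rpower z (- M / 2) * BesselJ (2 * INR j + M / 2) z
          * Gegenbauer (2 * j) (M / 2) w))
      (gfun m i (sv z w) (tv z w))
  else
    is_series
      (fun j : nat => - INR i * Rpower 2 (M / 2 - 2) * Gamma (M / 2 - 1) *
         ((4 * INR j + M - 2) * (dfact (2 * Z.of_nat j + I - 2) / dfact (2 * Z.of_nat j + mz - I - 2))
          * Rpower z (- M / 2 + 1) * BesselJ (2 * INR j + M / 2 - 1) z
          * Gegenbauer (2 * j) (M / 2 - 1) w))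
      (ftilde m i (sv z w) (tv z w))
    /\
    is_series
      (fun j : nat => - (-1) ^ ((m + 1) / 2) * Rpower 2 (M / 2 - 1) * Gamma (M / 2 - 1) *
         ((2 * INR j + M / 2) * (dfact (2 * Z.of_nat j + I) / dfact (2 * Z.of_nat j + mz - I - 2))
          * Rpower z (1 - M / 2) * BesselJ (2 * INR j + M / 2) z
          * Gegenbauer (2 * j + 1) (M / 2 - 1) w))
      (fhat m i (sv z w) (tv z w))
    /\
    is_series
      (fun j : nat => Rpower 2 (M / 2 - 1) * Gamma (M / 2) *
         ((4 * INR j + M + 2) * (dfact (2 * Z.of_nat j + I) / dfact (2 * Z.of_nat j + mz - I))
          * Rpower z (- M / 2) * BesselJ (2 * INR j + M / 2 + 1) z
          * Gegenbauer (2 * j + 1) (M / 2) w))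
      (gfun m i (sv z w) (tv z w)).
Proof.
  intros Hm Hodd Him z w Hz Hw M I mz.
  (* With m = 2 (a + 1) + 1, the index [a] belongs to m - 2, and i <= m - 2 is the bound i <= 2 a +
     1 required there. *)
  apply Nat.odd_spec in Hodd as [a' Ha]. destruct a' as [| a]; [lia |].
  set (lam := half_odd a).
  assert (HM : M / 2 = lam + 1)
    by (unfold M, lam, half_odd; rewrite Ha, INR_double_S, S_INR; field).
  assert (HM2 : M = 2 * lam + 2) by lra.
  assert (Hla : half_odd (S a) = lam + 1) by apply half_odd_S.
  replace (- M / 2 + 1) with (- lam) by lra. replace (- M / 2) with (- (lam + 1)) by lra.
  rewrite HM. replace (lam + 1 - 2) with (lam - 1) by ring.
  replace (1 - (lam + 1)) with (- lam) by ring.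
  replace (lam + 1 - 1) with lam by ring.
  assert (HR2 : Rpower 2 lam = 2 * Rpower 2 (lam - 1))
    by (rewrite Rpower_minus_1 by lra; field).
  unfold mz, I. clearbody M. subst m.
  destruct (Nat.even i) eqn:Ei.
  - repeat split.
    + destruct i as [| i].
      (* At i = 0 the prefactor i makes every term vanish, in agreement with [ftilde] being 0. *)
      * simpl ftilde. rewrite <- (Rmult_0_l (2 * 0)).
        eapply is_series_ext_R; [| apply is_series_scal_R, is_series_half].
        intros j. simpl. ring.
      * rewrite Nat.even_succ in Ei.
        assert (Eo : Nat.even i = false) by (rewrite <- Nat.negb_odd, Ei; reflexivity).
        rewrite ftilde_gfun.
        eapply is_series_ext_R;
          (* [ftilde] reduces to index i - 1, so its expansion is taken from the opposite parity. *)
          [| apply is_series_scal_R, (is_series_gfun_odd a i z w Hz Hw); [lia | exact Eo]].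
        intros j. cbv beta. fold lam.
        rewrite (dfact_nat_eq _ (2 * j + i)), (dfact_nat_eq _ (2 * j + 1 + 2 * a - i)) by lia.
        replace (2 * INR j + (lam + 1)) with (2 * INR j + 1 + lam) by ring.
        rewrite HM2. ring.
    + rewrite fhat_gfun, pow_add, (pow_m1_even i Ei), Rmult_1_r.
      eapply is_series_ext_R;
        [| apply is_series_scal_R, (is_series_gfun_even a i z w Hz Hw); [lia | exact Ei]].
      intros j. cbv beta. fold lam.
      (* At i = j = 0 the integer -1 is sent to 0 by [Z.to_nat], in accordance with the truncated
         natural subtraction, so both sides read (-1)!! as 1. *)
      rewrite (dfact_nat_eq _ (2 * j + i - 1)), (dfact_nat_eq _ (2 * j + 2 * a - i)) by lia.
      replace (2 * INR j + (lam + 1) - 1) with (2 * INR j + lam) by ring.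
      rewrite HR2. ring.
    + eapply is_series_ext_R;
        [| apply (is_series_gfun_even (S a) i z w Hz Hw); [lia | exact Ei]].
      intros j. cbv beta. rewrite Hla.
      rewrite (dfact_nat_eq _ (2 * j + i - 1)), (dfact_nat_eq _ (2 * j + 2 * S a - i)) by lia.
      replace (lam + 1 - 1) with lam by ring.
      rewrite HM2. ring.
  - repeat split.
    + destruct i as [| i]; [discriminate |].
      rewrite Nat.even_succ in Ei.
      assert (Ee : Nat.even i = true) by (rewrite <- Nat.negb_odd, Ei; reflexivity).
      rewrite ftilde_gfun.
      eapply is_series_ext_R;
        [| apply is_series_scal_R, (is_series_gfun_even a i z w Hz Hw); [lia | exact Ee]].
      intros j. cbv beta. fold lam.
      rewrite (dfact_nat_eq _ (2 * j + i - 1)), (dfact_nat_eq _ (2 * j + 2 * a - i)) by lia.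
      replace (2 * INR j + (lam + 1) - 1) with (2 * INR j + lam) by ring.
      rewrite HM2. ring.
    + rewrite fhat_gfun, pow_add, (pow_m1_odd i Ei).
      eapply is_series_ext_R;
        [| apply is_series_scal_R, (is_series_gfun_odd a i z w Hz Hw); [lia | exact Ei]].
      intros j. cbv beta. fold lam.
      rewrite (dfact_nat_eq _ (2 * j + i)), (dfact_nat_eq _ (2 * j + 1 + 2 * a - i)) by lia.
      replace (2 * INR j + (lam + 1)) with (2 * INR j + 1 + lam) by ring.
      rewrite HR2. ring.
    + eapply is_series_ext_R;
        [| apply (is_series_gfun_odd (S a) i z w Hz Hw); [lia | exact Ei]].
      intros j. cbv beta. rewrite Hla.
      rewrite (dfact_nat_eq _ (2 * j + i)), (dfact_nat_eq _ (2 * j + 1 + 2 * S a - i)) by lia.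
      replace (lam + 1 - 1) with lam by ring.
      replace (2 * INR j + (lam + 1) + 1) with (2 * INR j + 1 + (lam + 1)) by ring.
      rewrite HM2. ring.
Qed.
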